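(* The set of valid formulas of $\mathrm{SL}( *,-\!*,\mathrm{ls})$ (formulas satisfied by every memory state) is not recursively enumerable.
   Context: Fix a countably infinite set $\mathrm{PVAR}$ of program variables and a countably infinite set $\mathrm{LOC}$ of locations (e.g. $\mathbb{N}$). A memory state is a pair $(s,h)$ where $s:\mathrm{PVAR}\to\mathrm{LOC}$ (the store) and $h$ is a partial function $\mathrm{LOC}\to\mathrm{LOC}$ with finite domain $\mathrm{dom}(h)$ (the heap). Heaps $h_1,h_2$ are disjoint if $\mathrm{dom}(h_1)\cap\mathrm{dom}(h_2)=\emptyset$; then $h_1+h_2$ denotes their union. Formulas of $\mathrm{SL}( *,-\!*,\mathrm{ls})$ are built from atomic formulas $x=y$, $x\hookrightarrow y$, $\mathrm{ls}(x,y)$, $\mathrm{emp}$ (with $x,y\in\mathrm{PVAR}$) using $\neg$, $\wedge$, $*$ and $-\!*$. Semantics: $(s,h)\models x=y$ iff $s(x)=s(y)$; $(s,h)\models\mathrm{emp}$ iff $\mathrm{dom}(h)=\emptyset$; $(s,h)\models x\hookrightarrow y$ iff $s(x)\in\mathrm{dom}(h)$ and $h(s(x))=s(y)$; $(s,h)\models\mathrm{ls}(x,y)$ iff either ($\mathrm{dom}(h)=\emptyset$ and $s(x)=s(y)$) or $h=\{l_0\mapsto l_1,\dots,l_{n-1}\mapsto l_n\}$ with $n\ge 1$, $l_0=s(x)$, $l_n=s(y)$ and $l_0,\dots,l_n$ pairwise distinct; Boolean connectives as usual; $(s,h)\models\varphi_1*\varphi_2$ iff there are disjoint $h_1,h_2$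 with $h=h_1+h_2$, $(s,h_1)\models\varphi_1$, $(s,h_2)\models\varphi_2$; $(s,h)\models\varphi_1-\!*\varphi_2$ iff for every heap $h_1$ disjoint from $h$ with $(s,h_1)\models\varphi_1$ we have $(s,h+h_1)\models\varphi_2$. *)

(* Defs.v *)
From HB Require Import structures.
From mathcomp Require Import all_boot.
From mathcomp Require Import finmap.
From mathcomp Require Import zify.

Set Implicit Arguments.
Unset Strict Implicit.
Unset Printing Implicit Defensive.

Local Open Scope nat_scope.

Notation PVAR := nat (only parsing).
Notation LOC := nat (only parsing).

Definition store : Type := PVAR -> LOC.
Definition heap : Type := {fmap LOC -> LOC}.

Definition hdisj (h1 h2 : heap) : bool := [disjoint domf h1 & domf h2]%fset.

Inductive form : Type :=
| FEq   of PVAR & PVAR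
| FPto  of PVAR & PVAR
| FLs   of PVAR & PVAR
| FEmp
| FNeg  of form
| FAnd  of form & form
| FStar of form & form
| FWand of form & form.

(* h = {l 0 |-> l 1, ..., l (n-1) |-> l n} with l 0, ..., l n pairwise
   distinct; values of l beyond n are irrelevant. *)
Definition is_path_heap (h : heap) (n : nat) (l : nat -> LOC) : Prop :=
  (forall i j, i <= n -> j <= n -> l i = l j -> i = j) /\
  (forall a b : LOC,
     h.[? a]%fmap = Some b <-> exists2 i, i < n & a = l i /\ b = l i.+1).

Definition sat_ls (s : store) (h : heap) (x y : PVAR) : Prop :=
  (domf h = fset0 /\ s x = s y) \/
  (exists (n : nat) (l : nat -> LOC),
     [/\ 1 <= n, l 0 = s x, l n = s y & is_path_heap h n l]).

Fixpoint sat (s : store) (h : heap) (phi : form) {struct phi} : Prop :=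
  match phi with
  | FEq x y => s x = s y
  | FPto x y => h.[? s x]%fmap = Some (s y)
  | FLs x y => sat_ls s h x y
  | FEmp => domf h = fset0
  | FNeg p => ~ sat s h p
  | FAnd p q => sat s h p /\ sat s h q
  | FStar p q => exists h1 h2 : heap,
      [/\ hdisj h1 h2, h = (h1 + h2)%fset, sat s h1 p & sat s h2 q]
  | FWand p q => forall h1 : heap,
      hdisj h h1 -> sat s h1 p -> sat s (h + h1)%fset q
  end.

Definition valid (phi : form) : Prop :=
  forall (s : store) (h : heap), sat s h phi.

(* Kleene's schemes, indexed by arity. *)
Inductive recf : nat -> Type :=
| RZero n : recf n
| RSucc : recf 1
| RProj n (i : 'I_n) : recf n
| RComp k n (f : recf k) (g : 'I_k -> recf n) : recf n
| RPrec n (f : recf n) (g : recf n.+2) : recf n.+1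
| RMu n (f : recf n.+1) : recf n.

(* [graph f v y] means that f converges on v with value y.  Primitive
   recursion and minimization both act on the first argument:
     h(0, v) = f(v),  h(m+1, v) = g(m, h(m, v), v);
     mu f (v) = the least y with f(y, v) = 0, where f(z, v) must converge
     for every z < y. *)
Fixpoint graph (n : nat) (f : recf n) {struct f} :
    n.-tuple nat -> nat -> Prop :=
  match f in recf n return n.-tuple nat -> nat -> Prop with
  | RZero n => fun _ y => y = 0
  | RSucc => fun v y => y = (thead v).+1
  | RProj n i => fun v y => y = tnth v i
  | RComp k n f g => fun v y =>
      exists2 w : k.-tuple nat,
        (forall i, graph (g i) v (tnth w i)) & graph f w y
  | RPrec n f g => fun v y =>
      let u : n.-tuple nat := [tuple of behead v] in
      let fix prec (m z : nat) {struct m} : Prop :=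
        match m with
        | 0 => graph f u z
        | m'.+1 =>
            exists2 t, prec m' t & graph g [tuple of m' :: t :: u] z
        end in
      prec (thead v) y
  | RMu n f => fun v y =>
      graph f [tuple of y :: v] 0 /\
      (forall z, z < y -> exists t, graph f [tuple of z :: v] t.+1)
  end.

(* A set of natural numbers is r.e. iff it is the domain of a unary partial
   recursive function. *)
Definition nat_re (A : nat -> Prop) : Prop :=
  exists f : recf 1, forall x, A x <-> exists y, graph f [tuple x] y.

(* Cantor's pairing bijection nat * nat -> nat: (a+b)(a+b+1)/2 + b. *)
Definition cpair (a b : nat) : nat := 'C((a + b).+1, 2) + b.

Fixpoint gnum (phi : form) : nat :=
  match phi with
  | FEq x y => cpair 0 (cpair x y)
  | FPto x y => cpair 1 (cpair x y)
  | FLs x y => cpair 2 (cpair x y)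
  | FEmp => cpair 3 0
  | FNeg p => cpair 4 (gnum p)
  | FAnd p q => cpair 5 (cpair (gnum p) (gnum q))
  | FStar p q => cpair 6 (cpair (gnum p) (gnum q))
  | FWand p q => cpair 7 (cpair (gnum p) (gnum q))
  end.

Lemma cpair_inj a b c d : cpair a b = cpair c d -> a = c /\ b = d.
Proof.
rewrite /cpair => E.
suff Es : a + b = c + d by move: E; rewrite Es; lia.
have key m n k : m < n -> k <= m -> 'C(m.+1, 2) + k < 'C(n.+1, 2).
  move=> lt_mn le_km; apply: (@leq_trans 'C(m.+2, 2)).
    by rewrite (binS m.+1 1) bin1; lia.
  exact: leq_bin2l.
case: (ltngtP (a + b) (c + d)) => // lt.
- have := key _ _ b lt (leq_addl _ _); lia.
- have := key _ _ d lt (leq_addl _ _); lia.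
Qed.

Lemma gnum_inj : injective gnum.
Proof.
elim=> [x y|x y|x y||p IHp|p IHp q IHq|p IHp q IHq|p IHp q IHq]
  [x' y'|x' y'|x' y'||p'|p' q'|p' q'|p' q'] //= /cpair_inj [] // _;
  try by move=> /cpair_inj [-> ->].
- by move/IHp ->.
- by move/cpair_inj => [/IHp -> /IHq ->].
- by move/cpair_inj => [/IHp -> /IHq ->].
- by move/cpair_inj => [/IHp -> /IHq ->].
Qed.

Definition form_re (A : form -> Prop) : Prop :=
  nat_re (fun n => exists2 phi, n = gnum phi & A phi).

(* Main.v *)
(** To every partial recursive function f of one argument one associates a formula A such that f
    converges at n iff A /\ In(n+1) is satisfiable, where In(k) says that k cells point to the
    value of a fixed variable.  The code d(c) of the formula ~ (A /\ In(c+1)), where c is the code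
    of A, depends recursively on c.  If the codes of valid formulas were the domain of f, then, for
    the formula A associated with f o d and its code c, the formula ~ (A /\ In(c+1)) would be valid
    iff f converges at d(c), that is, iff A /\ In(c+1) is satisfiable.

    To find A, a converging computation of f is represented by a finite set of facts "g(v) = y"
    about the subterms g of f, each of which follows from others by a rule that only speaks about
    equality, successor and zero of the entries of a few facts.  A fact is stored in the heap as a
    chain, whose entries are the in-degrees of certain nodes of the chain; the argument of f is
    the in-degree that In(n+1) fixes.

    Such a heap is described in a first-order logic whose variables are simulated by cells s x -> c
    added with the magic wand.  With the help of one further cell, ls compares the contents of two
    such cells.  The in-degrees of two nodes a and b are compared by cutting the edges into a and
    then adding edges that map the former predecessors of a injectively to those of b. *)

Require Import Defs.
From HB Require Import structures.
From mathcomp Require Import all_boot finmap zify.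
From Stdlib Require Import Classical.

Set Implicit Arguments.
Unset Strict Implicit.
Unset Printing Implicit Defensive.

Local Open Scope nat_scope.
Local Open Scope fmap_scope.

(** * Heaps *)

Lemma eq_heap (h1 h2 : heap) :
  (forall u v, h1.[? u] = Some v <-> h2.[? u] = Some v) -> h1 = h2.
Proof.
move=> E; apply/fmapP => u; case h1u: h1.[? u] => [v|]; first by apply/esym/E.
by case h2u: h2.[? u] => [v|//]; rewrite -h1u; apply/E.
Qed.

Lemma hdisjP (h1 h2 : heap) :
  hdisj h1 h2 <-> forall u, h1.[? u] = None \/ h2.[? u] = None.
Proof.
split=> [/fdisjointP d u | d].
  by case: (fndP h1 u) => [u1 | _]; [right; rewrite not_fnd // d | left].
apply/fdisjointP => u u1; case: (d u); first by rewrite (in_fnd u1).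
by rewrite -fndSome => ->.
Qed.

Lemma fnd_hadd (h1 h2 : heap) u : hdisj h1 h2 ->
  (h1 + h2)%fset.[? u] = if h1.[? u] is Some v then Some v else h2.[? u].
Proof.
move/hdisjP/(_ u) => d; rewrite fnd_cat -fndSome.
by case: d => ->; case: fnd.
Qed.

Lemma fnd_hadd_some (h1 h2 : heap) u v : hdisj h1 h2 ->
  (h1 + h2)%fset.[? u] = Some v <-> h1.[? u] = Some v \/ h2.[? u] = Some v.
Proof.
move=> d; rewrite fnd_hadd //; have /hdisjP/(_ u)[] := d => -> //.
  by split=> [|[]] //; right.
by case: h1.[? u] => [w|]; split=> [|[]] //; left.
Qed.

Lemma fnd_filterf_some (h : heap) P u v :
  (filterf h P).[? u] = Some v <-> P u /\ h.[? u] = Some v.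
Proof. by rewrite fnd_filterf; case: (P u); split=> // -[]. Qed.

Lemma hdisj_filterf (h : heap) P : hdisj (filterf h P) (filterf h (predC P)).
Proof.
by apply/hdisjP => u; rewrite !fnd_filterf /=; case: (P u); [right | left].
Qed.

Lemma hadd_filterf (h : heap) P : h = (filterf h P + filterf h (predC P))%fset.
Proof.
apply/fmapP => u; rewrite fnd_hadd ?hdisj_filterf // !fnd_filterf /=.
by case: (P u); case: h.[? u].
Qed.

Definition cell (u v : LOC) : heap := [fmap].[u <- v].

Lemma fnd_cell u v w : (cell u v).[? w] = if w == u then Some v else None.
Proof. by rewrite /cell fnd_set fnd_fmap0. Qed.

Lemma hdisj_cell (h : heap) u v : hdisj h (cell u v) <-> h.[? u] = None.
Proof.
rewrite hdisjP; split=> [/(_ u) | hu w]; rewrite fnd_cell.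
  by rewrite eqxx; case.
by case: eqP => [-> | _]; [left | right].
Qed.

Lemma hadd_cell (h : heap) u v : (h + cell u v)%fset = h.[u <- v].
Proof. by rewrite /cell catf_setr catf0. Qed.

Definition heap_of (A : seq LOC) (F : LOC -> option LOC) : heap :=
  reducef [fmap u : [fset u in A]%fset => F (val u)].

Lemma fnd_heap_of A F u : (heap_of A F).[? u] = if u \in A then F u else None.
Proof.
rewrite fnd_reducef; case: fndP => [uA | ]; last by rewrite inE => /negbTE->.
by rewrite ffunE /=; have := uA; rewrite inE => ->.
Qed.

(** * Derived connectives *)

Section Connectives.
Variable s : store.
Implicit Types (h : heap) (p q : form).

Definition FTrue := FNeg (FAnd FEmp (FNeg FEmp)).
Definition FOr p q := FNeg (FAnd (FNeg p) (FNeg q)).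
Definition FImp p q := FOr (FNeg p) q.
Definition FSept p q := FNeg (FWand p (FNeg q)).
Definition FSub p := FStar p FTrue.
Definition FAlloc x := FWand (FPto x x) (FNeg FTrue).
Definition FOne := FAnd (FNeg FEmp) (FNeg (FStar (FNeg FEmp) (FNeg FEmp))).
Definition FBigAnd (l : seq form) := foldr FAnd FTrue l.

Lemma sat_true h : sat s h FTrue.
Proof. by move=> []. Qed.

Lemma sat_and h p q : sat s h (FAnd p q) <-> sat s h p /\ sat s h q.
Proof. by []. Qed.

Lemma sat_neg h p : sat s h (FNeg p) <-> ~ sat s h p.
Proof. by []. Qed.

Lemma sat_or h p q : sat s h (FOr p q) <-> sat s h p \/ sat s h q.
Proof. by rewrite /=; split=> [|[]]; tauto. Qed.

Lemma sat_imp h p q : sat s h (FImp p q) <-> (sat s h p -> sat s h q).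
Proof. by rewrite sat_or sat_neg; tauto. Qed.

Lemma sat_bigand (T : eqType) h (F : T -> form) l :
  sat s h (FBigAnd (map F l)) <-> forall x, x \in l -> sat s h (F x).
Proof.
elim: l => [|x l IH] /=; first by split=> // _ [].
rewrite IH; split=> [[Fx Fl] y | Fl].
  by rewrite in_cons => /predU1P[-> | /Fl].
by split=> [|y yl]; apply: Fl; rewrite in_cons ?eqxx ?yl ?orbT.
Qed.

Lemma sat_star h p q : sat s h (FStar p q) <->
  exists P : pred LOC, sat s (filterf h P) p /\ sat s (filterf h (predC P)) q.
Proof.
split=> [[h1 [h2 [d -> h1p h2q]]] | [P [hp hq]]]; last first.
  by exists (filterf h P), (filterf h (predC P)); rewrite hdisj_filterf -hadd_filterf.
exists (fun u => h1.[? u] != None).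
have [-> ->] : filterf (h1 + h2)%fset (fun u => h1.[? u] != None) = h1 /\
    filterf (h1 + h2)%fset (predC (fun u => h1.[? u] != None)) = h2; last by [].
split; apply/fmapP => u; rewrite fnd_filterf fnd_hadd //=; first by case: h1.[? u].
by move/hdisjP/(_ u): d; case: h1.[? u] => //= v [|->].
Qed.

Lemma sat_sub h p : sat s h (FSub p) <-> exists P : pred LOC, sat s (filterf h P) p.
Proof.
rewrite sat_star; split=> [[P [hp _]] | [P hp]]; first by exists P.
by exists P; split=> //; apply: sat_true.
Qed.

Lemma sat_sept h p q : sat s h (FSept p q) <->
  exists h', [/\ hdisj h h', sat s h' p & sat s (h + h')%fset q].
Proof.
split=> [/= H | [h' [d h'p hq]] /(_ h')]; last exact.
apply: NNPP => N; apply: H => h' d h'p hq.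
by apply: N; exists h'.
Qed.

Lemma sat_alloc h x : sat s h (FAlloc x) <-> h.[? s x] <> None.
Proof.
split=> [H E | hx h' /hdisjP/(_ (s x))[] // -> //].
have /sat_neg[] // : sat s (h + cell (s x) (s x))%fset (FNeg FTrue); last exact: sat_true.
by apply: H; [apply/hdisj_cell | rewrite /= fnd_cell eqxx].
Qed.

Lemma sat_emp h : sat s h FEmp <-> forall u, h.[? u] = None.
Proof.
rewrite /=; split=> [/fmap_nil -> u | h0]; first by rewrite fnd_fmap0.
by apply/fsetP => u; rewrite inE -[_ \in _]/(u \in h) -fndSome h0.
Qed.

Lemma sat_one h : sat s h FOne <-> exists u v, h = cell u v.
Proof.
rewrite sat_and !sat_neg sat_star; split=> [[hn0 hN1] | [u [v ->]]].
  have [u [v huv]] : exists u v, h.[? u] = Some v.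
    apply: NNPP => N; apply/hn0/sat_emp => u.
    by case hu: h.[? u] => [v|//]; case: N; exists u, v.
  exists u, v; apply: NNPP => N; apply: hN1; exists (pred1 u).
  rewrite !sat_neg !sat_emp; split=> [/(_ u) | H]; first by rewrite fnd_filterf /= eqxx huv.
  apply: N; apply/fmapP => w; rewrite fnd_cell; case: eqP => [-> // | /eqP wu].
  by have := H w; rewrite fnd_filterf /= wu.
split=> [/sat_emp/(_ u) | [P]]; first by rewrite fnd_cell eqxx.
rewrite !sat_neg !sat_emp; case: (boolP (P u)) => Pu [N1 N2]; [apply: N2 | apply: N1] => w;
  by rewrite fnd_filterf fnd_cell /=; case: eqP => [->|_]; rewrite ?Pu ?if_same // (negbTE Pu).
Qed.

Lemma sat_sept_one h p q : sat s h (FSept (FAnd FOne p) q) <->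
  exists u v, [/\ h.[? u] = None, sat s (cell u v) p & sat s h.[u <- v] q].
Proof.
rewrite sat_sept; split=> [[h' [d [/sat_one[u [v E]] h'p] hq]] | [u [v [hu up hq]]]].
  by move: d h'p hq; rewrite E hadd_cell => /hdisj_cell d h'p hq; exists u, v.
exists (cell u v); rewrite hadd_cell; split=> //; first exact/hdisj_cell.
by split=> //; apply/sat_one; exists u, v.
Qed.

Definition cells (Q : rel LOC) h : seq LOC :=
  [seq u <- domf h | if h.[? u] is Some v then Q u v else false].

Lemma cells_uniq Q h : uniq (cells Q h).
Proof. by rewrite filter_uniq ?fset_uniq. Qed.

Lemma mem_cells (Q : rel LOC) h u :
  u \in cells Q h <-> exists2 v, h.[? u] = Some v & Q u v.
Proof.
rewrite mem_filter -[_ \in domf h]/(u \in h) -fndSome; split=> [/andP[] | [v -> ->] //].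
by case: h.[? u] => // v Quv _; exists v.
Qed.

Lemma size_cells (Q : rel LOC) h (l : seq LOC) : uniq l ->
  (forall u, u \in l <-> exists2 v, h.[? u] = Some v & Q u v) -> size (cells Q h) = size l.
Proof.
move=> l_uniq lP; apply/perm_size/uniq_perm => // [|u]; first exact: cells_uniq.
by apply/idP/idP => [/mem_cells/lP | /lP/mem_cells].
Qed.

Lemma size_cells_filterf (Q : rel LOC) h P :
  size (cells Q h) = size (cells Q (filterf h P)) + size (cells Q (filterf h (predC P))).
Proof.
have restrict P' : size (cells Q (filterf h P')) = count P' (cells Q h).
  rewrite -size_filter; apply: size_cells => [|u]; first by rewrite filter_uniq ?cells_uniq.
  rewrite mem_filter; split=> [/andP[P'u /mem_cells[v huv Quv]] | [v]].
    by exists v => //; apply/fnd_filterf_some.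
  by move=> /fnd_filterf_some[-> huv] Quv; apply/mem_cells; exists v.
by rewrite !restrict count_predC.
Qed.

Lemma cells_nil (Q : rel LOC) h :
  size (cells Q h) = 0 <-> forall u v, h.[? u] = Some v -> ~~ Q u v.
Proof.
split=> [/size0nil h0 u v huv | h0].
  apply/negP => Quv; suff : u \in cells Q h by rewrite h0.
  by apply/mem_cells; exists v.
by apply: (size_cells (l := [::])) => // u; split=> // -[v /h0/negbTE->].
Qed.

(* Under the separating conjunction, p takes one Q-cell at a time and q says that none is left. *)
Lemma sat_iter_star (I : heap -> Prop) (Q : rel LOC) p q :
  (forall h P, I h -> I (filterf h P)) ->
  (forall h, I h -> sat s h p <-> exists u v, h = cell u v /\ Q u v) ->
  (forall h, I h -> sat s h q <-> size (cells Q h) = 0) ->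
  forall n h, I h -> sat s h (iter n (FStar p) q) <-> size (cells Q h) = n.
Proof.
move=> IF pP qP; have size_cell u v : Q u v -> size (cells Q (cell u v)) = 1.
  move=> Quv; apply: (size_cells (l := [:: u])) => // w; rewrite inE fnd_cell.
  by case: eqP => [-> | _]; [split=> // _; exists v | split=> // -[]].
elim=> [|n IH] h Ih; first exact: qP.
rewrite iterS sat_star; split=> [[P []] | hn].
  move=> /(pP _ (IF _ _ Ih))[u [v [hu Quv]]] /(IH _ (IF _ _ Ih)) hn.
  by rewrite (size_cells_filterf Q h P) hn hu size_cell.
have [u [v huv Quv]] : exists u, exists2 v, h.[? u] = Some v & Q u v.
  by case: (cells Q h) (@mem_cells Q h) hn => // u ? H _; exists u; apply/H; rewrite mem_head.
have hu : filterf h (pred1 u) = cell u v.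
  by apply/fmapP => w; rewrite fnd_filterf fnd_cell /=; case: eqP => [->|].
exists (pred1 u); split; first by apply/(pP _ (IF _ _ Ih)); exists u, v.
apply/(IH _ (IF _ _ Ih)).
by move: hn; rewrite (size_cells_filterf Q h (pred1 u)) hu size_cell // => -[].
Qed.

Definition FSize n := iter n (FStar FOne) FEmp.

Lemma sat_size h n : sat s h (FSize n) <-> size (cells (fun _ _ => true) h) = n.
Proof.
apply: (sat_iter_star (I := fun=> True)) => {h n} // h _; rewrite ?sat_one ?sat_emp ?cells_nil.
  by split=> [[u [v ->]] | [u [v [-> _]]]]; exists u, v.
by split=> [h0 u v | h0 u]; [rewrite h0 | case hu: h.[? u] => [v|//]; have := h0 u v hu].
Qed.

Definition FReach n x z := FSub (FAnd (FLs x z) (FSize n)).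

Lemma is_path_heap_size h n l : is_path_heap h n l -> size (cells (fun _ _ => true) h) = n.
Proof.
move=> [l_inj hl]; rewrite (@size_cells _ _ [seq l i | i <- iota 0 n]).
- by rewrite size_map size_iota.
- rewrite map_inj_in_uniq ?iota_uniq // => i j; rewrite !mem_iota => Hi Hj.
  by apply: l_inj; lia.
move=> u; split=> [/mapP[i] | [v huv _]].
  by rewrite mem_iota => Hi ->; exists (l i.+1) => //; apply/hl; exists i; [lia|].
have [i Hi [-> _]] := (hl u v).1 huv.
by rewrite map_f // mem_iota.
Qed.

Lemma sat_reach h n x z : 0 < n -> sat s h (FReach n x z) <->
  exists l : nat -> LOC, [/\ l 0 = s x, l n = s z,
    forall i j, i <= n -> j <= n -> l i = l j -> i = j &
    forall i, i < n -> h.[? l i] = Some (l i.+1)].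
Proof.
move=> n_gt0; rewrite sat_sub; split=> [[P [hls /sat_size hn]] | [l [l0 ln l_inj hl]]].
  case: hls => [[/sat_emp h0 _] | [m [l [_ l0 lm pl]]]].
    by move: hn n_gt0 => <-; rewrite (cells_nil _ _).2 // => u v; rewrite h0.
  have mn : m = n by rewrite -hn (is_path_heap_size pl).
  subst m; have [l_inj hl] := pl.
  exists l; split=> // i Hi.
  have /fnd_filterf_some[] // : (filterf h P).[? l i] = Some (l i.+1) by apply/hl; exists i.
have pl : is_path_heap (filterf h (fun u => u \in [seq l i | i <- iota 0 n])) n l.
  split=> // u v; rewrite fnd_filterf_some; split=> [[/mapP[i]] | [i Hi [-> ->]]].
    by rewrite mem_iota => Hi -> /[!hl] // -[<-]; exists i.
  by rewrite hl // map_f // mem_iota.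
exists (fun u => u \in [seq l i | i <- iota 0 n]); split; first by right; exists n, l.
exact/sat_size/(is_path_heap_size pl).
Qed.

Lemma sat_reach2 h x z : sat s h (FReach 2 x z) <->
  exists a, [/\ h.[? s x] = Some a, h.[? a] = Some (s z) & uniq [:: s x; a; s z]].
Proof.
rewrite sat_reach //; split=> [[l [l0 l2 l_inj hl]] | [a [hx ha u]]].
  exists (l 1); rewrite -l0 -l2 !hl //; split=> //.
  by rewrite (map_inj_in_uniq (s := iota 0 3)) // => i j; rewrite !mem_iota; apply: l_inj.
exists (nth (s z) [:: s x; a; s z]); split=> // [i j Hi Hj /eqP | [|[|i]] //].
by rewrite nth_uniq // => /eqP.
Qed.

Lemma sat_reach3 h x z : sat s h (FReach 3 x z) <->
  exists a b, [/\ h.[? s x] = Some a, h.[? a] = Some b, h.[? b] = Some (s z) &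
    uniq [:: s x; a; b; s z]].
Proof.
rewrite sat_reach //; split=> [[l [l0 l3 l_inj hl]] | [a [b [hx ha hb u]]]].
  exists (l 1), (l 2); rewrite -l0 -l3 !hl //; split=> //.
  by rewrite (map_inj_in_uniq (s := iota 0 4)) // => i j; rewrite !mem_iota; apply: l_inj.
exists (nth (s z) [:: s x; a; b; s z]); split=> // [i j Hi Hj /eqP | [|[|[|i]]] //].
by rewrite nth_uniq // => /eqP.
Qed.

(* The cell allocated at y detects, with one further cell, any other cell that points to z. *)
Definition FNotInto y z := FNeg (FSept (FAnd FOne (FAlloc y)) (FReach 2 y z)).

Lemma sat_notinto h y z : s y <> s z -> h.[? s y] = None ->
  sat s h (FNotInto y z) <-> forall u, u <> s z -> h.[? u] <> Some (s z).
Proof.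
move=> yz hy; rewrite sat_neg sat_sept_one; split=> [N u uz huz | H].
  have yu : s y != u by apply: contra_eq_neq hy => ->; rewrite huz.
  apply: N; exists (s y), u; split=> //; first by apply/sat_alloc; rewrite fnd_cell eqxx.
  apply/sat_reach2; exists u; rewrite !fnd_set eqxx eq_sym (negbTE yu); split=> //=.
  by rewrite !inE negb_or yu !andbT; apply/andP; split; apply/eqP.
case=> u [v [_ /sat_alloc]]; rewrite fnd_cell; case: eqP => // <- _.
case/sat_reach2=> a [_ ha]; rewrite /= !inE negb_or => /and3P[/andP[ya _] /eqP az _].
by move: ha; rewrite fnd_set eq_sym (negbTE ya) => /(H a az).
Qed.

End Connectives.

(** * Comparison of in-degrees *)

Section Indegree.
Implicit Types (g : heap) (k : bool).

Definition preds g a : seq LOC := cells (fun _ v => v == a) g.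
Definition indeg g a : nat := size (preds g a).

Lemma mem_preds g a u : (u \in preds g a) = (g.[? u] == Some a).
Proof.
apply/idP/eqP => [/mem_cells[v -> /eqP-> //] | gu].
by apply/mem_cells; exists a.
Qed.

Lemma mem_filter_preds g a P u :
  (u \in [seq w <- preds g a | P w]) = P u && (g.[? u] == Some a).
Proof. by rewrite mem_filter mem_preds. Qed.

Lemma preds_uniq g a : uniq (preds g a).
Proof. exact: cells_uniq. Qed.

Definition no_pred g a : Prop := forall u, g.[? u] <> Some a.

Definition injective_heap g : Prop :=
  forall u u' v, g.[? u] = Some v -> g.[? u'] = Some v -> u = u'.

(* At most k predecessors of a have a predecessor themselves. *)
Definition few_deep_preds k g a : Prop :=
  forall u w u' w', g.[? w] = Some u -> g.[? u] = Some a ->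
    g.[? w'] = Some u' -> g.[? u'] = Some a -> k /\ u = u'.

Definition near g b : Prop :=
  forall u v, g.[? u] = Some v ->
    v = b \/ g.[? v] = Some b \/ exists2 t, g.[? v] = Some t & g.[? t] = Some b.

Definition comparable_nodes g a b : Prop :=
  [/\ a <> b, g.[? b] <> Some a &
      forall u, g.[? u] = Some a -> exists w, g.[? w] = Some u].

(* P is the part of g that keeps the edges into a; once these are removed from the other part,
   g' maps the former predecessors of a injectively to those of b. *)
Definition matching k g a b (P : pred LOC) g' : Prop :=
  [/\ few_deep_preds k (filterf g P) a, no_pred (filterf g (predC P)) a,
      hdisj (filterf g (predC P)) g', no_pred g' b &
      injective_heap g' /\ near (filterf g (predC P) + g')%fset b].

Lemma size_leq_bool k (l : seq LOC) : uniq l ->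
  (forall u v, u \in l -> v \in l -> k /\ u = v) -> size l <= k.
Proof.
case: l => [|u [|v l]] //= l_uniq H; first by have [->] := H u u (mem_head _ _) (mem_head _ _).
have [|| _ uv] := H u v; rewrite ?inE ?eqxx ?orbT //.
by rewrite uv inE eqxx in l_uniq.
Qed.

Section MatchingSound.
Variables (k : bool) (g g' : heap) (a b : LOC) (P : pred LOC).
Hypotheses (ab : comparable_nodes g a b) (m : matching k g a b P g').

Let deep u := has (fun w => (filterf g P).[? w] == Some u) (domf g).

Lemma deepP u : reflect (exists w, (filterf g P).[? w] = Some u) (deep u).
Proof.
apply: (iffP hasP) => [[w _ /eqP wu] | [w wu]]; exists w; rewrite ?wu //.
by have [_ gw] := (fnd_filterf_some _ _ _ _).1 wu; rewrite -[_ \in _]/(w \in g) -fndSome gw.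
Qed.

Lemma kept_pred u : g.[? u] = Some a -> P u.
Proof.
have [_ cut _ _ _] := m => ua; apply: contraT => nPu.
by case: (cut u); apply/fnd_filterf_some.
Qed.

Lemma shallow_pred_matched u : g.[? u] = Some a -> ~~ deep u ->
  exists2 t, g'.[? u] = Some t & g.[? t] = Some b.
Proof.
have [_ _ d nob [_ gnear]] := m; have [_ nba deg_a] := ab.
move=> ua shallow; have [w wu] := deg_a u ua.
have wu2 : (filterf g (predC P)).[? w] = Some u.
  apply/fnd_filterf_some; split=> //=; apply: contra shallow => Pw.
  by apply/deepP; exists w; apply/fnd_filterf_some.
have u2 v : (filterf g (predC P) + g')%fset.[? u] = Some v -> g'.[? u] = Some v.
  by move=> /(fnd_hadd_some _ _ d)[/fnd_filterf_some[/=]|//]; rewrite kept_pred.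
have wu' : (filterf g (predC P) + g')%fset.[? w] = Some u by apply/(fnd_hadd_some _ _ d); left.
have [ub|[/u2/nob//|[t /u2 ut tb]]] := gnear w u wu'; first by case: nba; rewrite -ub.
exists t => //; case/(fnd_hadd_some _ _ d): tb => [/fnd_filterf_some[]//|].
by move/nob.
Qed.

Lemma indeg_leq_of_matching : indeg g a <= indeg g b + k.
Proof.
have [few _ _ _ [inj _]] := m.
rewrite /indeg -(count_predC deep) -!size_filter addnC leq_add //.
  pose f u := odflt 0 g'.[? u]; rewrite -(size_map f); apply: uniq_leq_size.
    rewrite map_inj_in_uniq ?filter_uniq ?preds_uniq // => u v.
    rewrite !mem_filter_preds => /andP[du /eqP ua] /andP[dv /eqP va].
    have [t ut _] := shallow_pred_matched ua du; have [t' vt' _] := shallow_pred_matched va dv.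
    by rewrite /f ut vt' => /= Et; apply: inj ut _; rewrite Et.
  move=> v /mapP[u]; rewrite mem_filter_preds => /andP[du /eqP ua] ->.
  by have [t ut tb] := shallow_pred_matched ua du; rewrite /f ut mem_preds; apply/eqP.
apply: size_leq_bool => [|u v]; first by rewrite filter_uniq ?preds_uniq.
rewrite !mem_filter_preds => /andP[/deepP[w wu] /eqP ua] /andP[/deepP[w' wv] /eqP va].
by apply: few wu _ wv _; apply/fnd_filterf_some; rewrite kept_pred.
Qed.

End MatchingSound.

Section MatchingComplete.
Variables (k : bool) (g : heap) (a b : LOC).
Hypotheses (noloop : forall u, g.[? u] <> Some u) (nab : a <> b).
Hypothesis le_ab : indeg g a <= indeg g b + k.

(* All but at most k predecessors of a, to be matched with predecessors of b. *)
Let matched := drop k (preds g a).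
Let partner u := nth 0 (preds g b) (index u matched).

(* The cells of the part from which the edges into a are cut. *)
Let moved u := (g.[? u] == Some b) || (if g.[? u] is Some v then v \in matched else false).

Let cut_heap := filterf g (predC (predC moved)).
Let added := heap_of matched (Some \o partner).

Lemma mem_matched u : u \in matched -> g.[? u] = Some a.
Proof. by move=> /mem_drop; rewrite mem_preds => /eqP. Qed.

Lemma index_matched u : u \in matched -> index u matched < indeg g b.
Proof.
rewrite -index_mem => /leq_trans; apply; rewrite size_drop leq_subLR.
by rewrite addnC.
Qed.

Lemma partner_pred u : u \in matched -> g.[? partner u] = Some b.
Proof. by move=> um; apply/eqP; rewrite -mem_preds mem_nth // index_matched. Qed.

Lemma partner_inj u v : u \in matched -> v \in matched -> partner u = partner v -> u = v.
Proof.
move=> um vm /eqP; rewrite nth_uniq ?index_matched ?preds_uniq // => /eqP E.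
by rewrite -(nth_index 0 um) E nth_index.
Qed.

Lemma fnd_cut u v : cut_heap.[? u] = Some v <-> g.[? u] = Some v /\ (v = b \/ v \in matched).
Proof.
rewrite fnd_filterf_some /= negbK /moved.
split=> [[+ guv] | [guv vb]]; rewrite guv; last first.
  by split=> //; apply/orP; case: vb => [->|]; [left | right].
by case/orP=> [/eqP[->]|]; auto.
Qed.

Lemma fnd_added u v : added.[? u] = Some v <-> u \in matched /\ v = partner u.
Proof. by rewrite fnd_heap_of /=; case: (u \in matched); split=> [[]|[]] // _ ->. Qed.

Lemma hdisj_cut_added : hdisj cut_heap added.
Proof.
apply/hdisjP => u; case g2u: cut_heap.[? u] => [v|]; last by left.
case g'u: added.[? u] => [w|]; [exfalso | by right].
have [um _] := (fnd_added _ _).1 g'u; have [] := (fnd_cut _ _).1 g2u.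
rewrite (mem_matched um) => -[<-] [//|/mem_matched]; exact: noloop.
Qed.

Lemma few_deep_preds_unmoved : few_deep_preds k (filterf g (predC moved)) a.
Proof.
have taken w u : (filterf g (predC moved)).[? w] = Some u ->
    (filterf g (predC moved)).[? u] = Some a -> u \in take k (preds g a).
  move=> /fnd_filterf_some[/= nwu wu] /fnd_filterf_some[_ /eqP].
  rewrite -mem_preds -{1}(cat_take_drop k (preds g a)) mem_cat => /orP[//|um].
  by move: nwu; rewrite /moved wu um orbT.
move=> u w u' w' wu ua wu' ua'; move: (taken w u wu ua) (taken w' u' wu' ua').
case: (k); last by rewrite take0.
by case: (preds g a) => // c l /=; rewrite take0 !inE => /eqP-> /eqP->.
Qed.

Lemma near_cut_added : near (cut_heap + added)%fset b.
Proof.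
have in2 u v : cut_heap.[? u] = Some v -> (cut_heap + added)%fset.[? u] = Some v.
  by move=> uv; apply/(fnd_hadd_some _ _ hdisj_cut_added); left.
have partner_to_b u : u \in matched -> (cut_heap + added)%fset.[? partner u] = Some b.
  by move=> um; apply/in2/fnd_cut; split; [exact: partner_pred | left].
move=> u v /(fnd_hadd_some _ _ hdisj_cut_added)[/fnd_cut[_ [->|vm]] | /fnd_added[um ->]].
- by left.
- right; right; exists (partner v); last exact: partner_to_b.
  by apply/(fnd_hadd_some _ _ hdisj_cut_added); right; apply/fnd_added.
- by right; left; apply: partner_to_b.
Qed.

Lemma matching_of_indeg_leq : exists P g', matching k g a b P g' /\
  forall u v, g'.[? u] = Some v -> g.[? u] = Some a /\ g.[? v] = Some b.
Proof.
exists (predC moved), added; split; last first.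
  by move=> u v /fnd_added[um ->]; rewrite (mem_matched um) (partner_pred um).
split; [exact: few_deep_preds_unmoved | | exact: hdisj_cut_added | |].
- by move=> u /fnd_cut[_ [//|/mem_matched]]; apply: noloop.
- by move=> u /fnd_added[um b_fu]; apply: (@noloop b); rewrite {1}b_fu partner_pred.
split; last exact: near_cut_added.
by move=> u u' v /fnd_added[um ->] /fnd_added[um']; apply: partner_inj.
Qed.

End MatchingComplete.
End Indegree.

(** * First-order logic of a heap *)

(* Variables are de Bruijn indices; FoLeq k i j is an atom that will compare the in-degrees of
   two nodes up to the slack k, and FoInput i says that i denotes a fixed location. *)
Inductive fo : Type :=
| FoBot
| FoEq of nat & nat
| FoEdge of nat & nat
| FoInput of nat
| FoLeq of bool & nat & nat
| FoAnd of fo & fo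
| FoOr of fo & fo
| FoImp of fo & fo
| FoEx of fo
| FoAll of fo.

Definition FoNeg phi := FoImp phi FoBot.

Definition fo_env : Type := nat -> option LOC.

Definition scons (c : LOC) (env : fo_env) : fo_env := fun i => if i is j.+1 then env j else Some c.

Definition both (env : fo_env) i j (R : LOC -> LOC -> Prop) : Prop :=
  if (env i, env j) is (Some a, Some b) then R a b else False.

Lemma bothE env i j R a b : env i = Some a -> env j = Some b -> both env i j R = R a b.
Proof. by rewrite /both => -> ->. Qed.

Lemma bothP env i j R :
  both env i j R <-> exists a b, [/\ env i = Some a, env j = Some b & R a b].
Proof.
rewrite /both; split=> [|[a [b [-> ->]]] //].
by case: (env i) => // a; case: (env j) => // b; exists a, b.
Qed.

Section Eval.
Variables (V : pred LOC) (input : LOC) (R : bool -> LOC -> LOC -> Prop) (g : heap).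

Fixpoint eval (env : fo_env) (phi : fo) : Prop :=
  match phi with
  | FoBot => False
  | FoEq i j => both env i j (fun a b => a = b)
  | FoEdge i j => both env i j (fun a b => g.[? a] = Some b)
  | FoInput i => env i = Some input
  | FoLeq k i j => both env i j (R k)
  | FoAnd p q => eval env p /\ eval env q
  | FoOr p q => eval env p \/ eval env q
  | FoImp p q => eval env p -> eval env q
  | FoEx p => exists2 c, V c & eval (scons c env) p
  | FoAll p => forall c, V c -> eval (scons c env) p
  end.

Lemma eq_eval env env' phi : env =1 env' -> eval env phi <-> eval env' phi.
Proof.
elim: phi env env' => [|i j|i j|i|k i j|p IHp q IHq|p IHp q IHq|p IHp q IHq|p IHp|p IHp]
  env env' E /=; rewrite /both ?E //; try by rewrite (IHp _ _ E) (IHq _ _ E).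
- have Ec c : scons c env =1 scons c env' by case.
  by split=> -[c Vc /(IHp _ _ (Ec c))]; exists c.
- have Ec c : scons c env =1 scons c env' by case.
  by split=> H c Vc; apply/(IHp _ _ (Ec c))/H.
Qed.

Lemma eval_and env p q : eval env (FoAnd p q) <-> eval env p /\ eval env q.
Proof. by []. Qed.

Lemma eval_or env p q : eval env (FoOr p q) <-> eval env p \/ eval env q.
Proof. by []. Qed.

Lemma eval_imp env p q : eval env (FoImp p q) <-> (eval env p -> eval env q).
Proof. by []. Qed.

Lemma eval_ex env p : eval env (FoEx p) <-> exists2 c, V c & eval (scons c env) p.
Proof. by []. Qed.

Lemma eval_all env p : eval env (FoAll p) <-> forall c, V c -> eval (scons c env) p.
Proof. by []. Qed.

Hypothesis gV : forall u v, g.[? u] = Some v -> V u /\ V v.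

Definition FoNoPred i := FoAll (FoNeg (FoEdge 0 i.+1)).

Definition FoFewDeepPreds (k : bool) i := FoAll (FoAll (FoAll (FoAll
  (FoImp (FoEdge 2 3) (FoImp (FoEdge 3 i.+4)
  (FoImp (FoEdge 0 1) (FoImp (FoEdge 1 i.+4) (if k then FoEq 3 1 else FoBot)))))))).

Definition FoInjective := FoAll (FoAll (FoAll
  (FoImp (FoEdge 2 0) (FoImp (FoEdge 1 0) (FoEq 2 1))))).

Definition FoNear i := FoAll (FoAll (FoImp (FoEdge 1 0)
  (FoOr (FoEq 0 i.+2) (FoOr (FoEdge 0 i.+2) (FoEx (FoAnd (FoEdge 1 0) (FoEdge 0 i.+3))))))).

Definition FoComparable i j :=
  FoAnd (FoNeg (FoEq i j)) (FoAnd (FoNeg (FoEdge j i))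
    (FoAll (FoImp (FoEdge 0 i.+1) (FoEx (FoEdge 0 1))))).

Section EvalAt.
Variables (env : fo_env) (i : nat) (a : LOC).
Hypothesis env_i : env i = Some a.

Lemma eval_no_pred : eval env (FoNoPred i) <-> no_pred g a.
Proof.
rewrite /= /both /= env_i; split=> [H u ua | H u _ /H //].
by have [Vu _] := gV ua; apply: (H u).
Qed.

Lemma eval_few_deep_preds k : eval env (FoFewDeepPreds k i) <-> few_deep_preds k g a.
Proof.
rewrite /= /both /= env_i; split=> [H u w u' w' wu ua wu' ua' | H u _ w _ u' _ w' _ wu ua wu' ua'].
  have [[Vw Vu] [Vw' Vu']] := (gV wu, gV wu').
  by have := H u Vu w Vw u' Vu' w' Vw' wu ua wu' ua'; case: (k).
by have := H u w u' w' wu ua wu' ua'; case: (k) => -[].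
Qed.

Lemma eval_near : eval env (FoNear i) <-> near g a.
Proof.
rewrite /= /both /= env_i; split=> [H u v uv | H u _ v _ /H].
  have [Vu Vv] := gV uv; have [|[|[t _ []]]] := H u Vu v Vv uv; auto.
  by right; right; exists t.
case=> [|[|[t vt ta]]]; auto; right; right; exists t => //.
by have [] := gV ta.
Qed.

End EvalAt.

Lemma eval_injective env : eval env FoInjective <-> injective_heap g.
Proof.
rewrite /= /both /=; split=> [H u u' v uv uv' | H u _ u' _ v _]; last exact: H.
by have [[Vu Vv] [Vu' _]] := (gV uv, gV uv'); apply: H uv uv'.
Qed.

Lemma eval_comparable env i j a b : env i = Some a -> env j = Some b ->
  eval env (FoComparable i j) <-> comparable_nodes g a b.
Proof.
rewrite /= /both /= => -> ->; split=> [[nab [nba H]] | [nab nba H]].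
  by split=> // u ua; have [Vu _] := gV ua; have [w _ wu] := H u Vu ua; exists w.
split=> //; split=> // u _ /H[w wu]; exists w => //.
by have [] := gV wu.
Qed.

End Eval.

Section Embedding.
Variables (s : store) (K : nat).
Hypothesis s_inj : forall x y, x <= K.+1 -> y <= K.+1 -> s x = s y -> x = y.
Implicit Types (h g : heap) (p q : form).

(* The location s 1 is a sink: it is never allocated and no cell points to it.  The other reserved
   locations are those of the cells that hold the values of the first-order variables; the number
   of these cells in use is the level of the formula. *)
Definition reserved u := u \in [seq s x | x <- iota 1 K.+1].
Definition visible u := ~~ reserved u.

Lemma reservedP u : reflect (exists2 x, 0 < x <= K.+1 & u = s x) (reserved u).
Proof.
by apply: (iffP mapP) => -[x xK ->]; exists x => //; move: xK; rewrite mem_iota add1n.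
Qed.

Lemma reserved_store x : 0 < x <= K.+1 -> reserved (s x).
Proof. by move=> xK; apply/reservedP; exists x. Qed.

Lemma visible_store x u : 0 < x <= K.+1 -> visible u -> s x != u.
Proof. by move=> xK; apply: contraNneq => <-; apply: reserved_store. Qed.

(* Loops are excluded because ls cannot detect them. *)
Definition visgraph (h : heap) : heap :=
  filterf h (fun u => visible u && (if h.[? u] is Some v then visible v && (u != v) else false)).

Definition is_visgraph (g : heap) : Prop :=
  forall u v, g.[? u] = Some v -> [/\ visible u, visible v & u <> v].

Lemma fnd_visgraph h u v :
  (visgraph h).[? u] = Some v <-> h.[? u] = Some v /\ [/\ visible u, visible v & u <> v].
Proof.
rewrite fnd_filterf_some; split=> [[/andP[Vu +] huv] | [huv [Vu Vv uv]]].
  by rewrite huv => /andP[Vv /eqP].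
by rewrite huv Vu Vv /=; split=> //; apply/eqP.
Qed.

Lemma visgraphP h : is_visgraph (visgraph h).
Proof. by move=> u v /fnd_visgraph[]. Qed.

Lemma visgraph_id g : is_visgraph g -> visgraph g = g.
Proof.
move=> Gg; apply: eq_heap => u v; rewrite fnd_visgraph; split=> [[]|guv] //.
by split=> //; apply: Gg.
Qed.

Lemma visgraph_filterf h P : visgraph (filterf h P) = filterf (visgraph h) P.
Proof.
by apply: eq_heap => u v; rewrite fnd_filterf_some !fnd_visgraph fnd_filterf_some; tauto.
Qed.

Lemma hdisj_visgraph h1 h2 : hdisj h1 h2 -> hdisj (visgraph h1) (visgraph h2).
Proof.
move=> /hdisjP d; apply/hdisjP => u.
by case: (d u) => hu; [left | right]; rewrite fnd_filterf hu if_same.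
Qed.

Lemma visgraph_hadd h1 h2 : hdisj h1 h2 ->
  visgraph (h1 + h2)%fset = (visgraph h1 + visgraph h2)%fset.
Proof.
move=> d; apply: eq_heap => u v.
rewrite fnd_visgraph fnd_hadd_some // (fnd_hadd_some _ _ (hdisj_visgraph d)) !fnd_visgraph; tauto.
Qed.

Lemma visgraph_set h u v : reserved u -> visgraph h.[u <- v] = visgraph h.
Proof.
move=> Ru; apply: eq_heap => w z; rewrite !fnd_visgraph fnd_set.
by case: eqP => [->|//]; rewrite /visible Ru; split=> -[_ []].
Qed.

Lemma eq_filterf_visgraph h P Q :
  (forall u, visible u -> P u = Q u) -> filterf (visgraph h) P = filterf (visgraph h) Q.
Proof.
move=> PQ; apply/fmapP => u; rewrite [LHS]fnd_filterf [RHS]fnd_filterf.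
case gu: (visgraph h).[? u] => [v|]; last by rewrite !if_same.
by have /fnd_visgraph[_ [Vu _ _]] := gu; rewrite PQ.
Qed.

(* l is the number of variables in scope, and the k-th of them is stored in the cell of s k.+1. *)
Definition config (h : heap) l : Prop :=
  [/\ forall x, (x == 1) || (l.+1 < x <= K.+1) -> h.[? s x] = None,
      forall u, h.[? u] <> Some (s 1) &
      forall x a, 0 < x <= K.+1 -> h.[? s x] = Some a -> visible a].

Definition slot l i := (l - i).+1.

Definition slot_env (h : heap) l : fo_env := fun i => h.[? s (slot l i)].

Lemma config_filterf h l P : config h l -> config (filterf h P) l.
Proof.
move=> [hfree hsink hvis]; split=> [x /hfree hx | u /fnd_filterf_some[_ /hsink] // | x a xK].
  by rewrite fnd_filterf hx if_same.
by move=> /fnd_filterf_some[_]; apply: hvis.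
Qed.

Lemma config_leq h l l' : l <= l' -> config h l -> config h l'.
Proof. by move=> le [hfree hsink hvis]; split=> // x xl; apply: hfree; lia. Qed.

Lemma config_hadd h1 h2 l : hdisj h1 h2 ->
  config h1 l -> config h2 l -> config (h1 + h2)%fset l.
Proof.
move=> d [free1 sink1 vis1] [free2 sink2 vis2]; split=> [x xl | u | x a xK].
- by rewrite fnd_hadd // free1 // free2.
- by rewrite fnd_hadd_some // => -[/sink1|/sink2].
- by rewrite fnd_hadd_some // => -[/(vis1 _ _ xK)|/(vis2 _ _ xK)].
Qed.

Lemma config_visgraph g l : is_visgraph g -> config g l.
Proof.
move=> Gg; have g_res x : 0 < x <= K.+1 -> g.[? s x] = None.
  move=> xK; case gx: g.[? s x] => [v|//].
  by have [] := Gg _ _ gx; rewrite /visible reserved_store.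
split=> [x xl | u /Gg[_] | x a xK]; first by apply: g_res; lia.
  by rewrite /visible reserved_store.
by rewrite g_res.
Qed.

Lemma config_set h l c : l < K -> visible c -> config h l -> config h.[s l.+2 <- c] l.+1.
Proof.
move=> lK Vc [hfree hsink hvis]; split=> [x xl | u | x a xK]; rewrite fnd_set.
- by case: eqP => [/s_inj|_]; [lia | apply: hfree; lia].
- case: eqP => [_ [c1] | _]; last exact: hsink.
  by move: Vc; rewrite c1 /visible reserved_store.
- by case: eqP => [_ [<-]|_] //; apply: hvis.
Qed.

Lemma slot_env_set h l c : l < K ->
  slot_env h.[s l.+2 <- c] l.+1 =1 scons c (slot_env h l).
Proof.
move=> lK [|i]; rewrite /slot_env fnd_set /slot; first by rewrite subn0 eqxx.
by rewrite subSS; case: eqP => // /s_inj; lia.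
Qed.

Definition FVisible x := FBigAnd [seq FNeg (FPto x y) | y <- iota 1 K.+1].
Definition FEx x p := FSept (FAnd FOne (FAnd (FAlloc x) (FVisible x))) p.
Definition FAll x p := FNeg (FEx x (FNeg p)).

Lemma sat_visible h x c : h.[? s x] = Some c -> sat s h (FVisible x) <-> visible c.
Proof.
move=> hx; rewrite sat_bigand; split=> [H | Vc y]; last first.
  rewrite mem_iota /= hx => yK [cy]; have := visible_store _ Vc.
  by move/(_ y); rewrite cy eqxx => /(_ yK).
apply/negP => /reservedP[y yK cy]; apply: (H y); first by rewrite mem_iota.
by rewrite /= hx cy.
Qed.

Lemma sat_ex h l p : config h l -> l < K ->
  sat s h (FEx l.+2 p) <-> exists2 c, visible c & sat s h.[s l.+2 <- c] p.
Proof.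
move=> [hfree _ _] lK; have cellP c : sat s (cell (s l.+2) c) (FVisible l.+2) <-> visible c.
  by apply: sat_visible; rewrite fnd_cell eqxx.
rewrite sat_sept_one; split=> [[u [c [_ /sat_and[/sat_alloc + Vc] pc]]]|[c Vc pc]].
  by rewrite fnd_cell; case: eqP => // E _; rewrite -E in pc Vc; exists c => //; apply/cellP.
exists (s l.+2), c; split=> //; first by apply: hfree; lia.
by split; [apply/sat_alloc; rewrite fnd_cell eqxx | apply/cellP].
Qed.

Lemma sat_all h l p : config h l -> l < K ->
  sat s h (FAll l.+2 p) <-> forall c, visible c -> sat s h.[s l.+2 <- c] p.
Proof.
move=> Ch lK; rewrite sat_neg sat_ex //; split=> [N c Vc | H [c /H]] //.
by apply: NNPP => npc; apply: N; exists c.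
Qed.

(* One further cell leads both contents to the sink iff they are equal. *)
Definition FSameContent x y :=
  FSub (FAnd (FAnd (FAlloc x) (FAlloc y))
    (FSept (FAnd FOne FTrue) (FAnd (FReach 2 x 1) (FReach 2 y 1)))).

(* The further cell can only be that of the content b of y; the content of x must point to b. *)
Definition FContentEdge x y :=
  FSub (FAnd (FAnd (FAlloc x) (FAlloc y))
    (FSept (FAnd FOne FTrue) (FAnd (FReach 3 x 1) (FReach 2 y 1)))).

Section Atoms.
Variables (h : heap) (l x y : nat).
Hypotheses (Ch : config h l) (xK : 0 < x <= K.+1) (yK : 0 < y <= K.+1).

Lemma content_unchanged P u v z :
  sat s (filterf h P) (FAlloc z) -> (filterf h P).[? u] = None ->
  exists2 c, h.[? s z] = Some c & (filterf h P).[u <- v].[? s z] = Some c.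
Proof.
move=> /sat_alloc; case hPz: (filterf h P).[? s z] => [c|//] _ hPu.
exists c; first by have /fnd_filterf_some[] := hPz.
by rewrite fnd_set; case: eqP => // zu; rewrite -zu hPz in hPu.
Qed.

Lemma new_cell_into_sink P u v a : (filterf h P).[u <- v].[? a] = Some (s 1) -> a = u.
Proof.
have [_ hsink _] := Ch.
by rewrite fnd_set; case: eqP => // _ /fnd_filterf_some[_ /hsink].
Qed.

Lemma uniq_to_sink z a : 0 < z <= K.+1 -> h.[? s z] = Some a -> uniq [:: s z; a; s 1].
Proof.
have [hfree _ hvis] := Ch; move=> zK hz; have Va := hvis z a zK hz.
rewrite /= !inE negb_or [a == _]eq_sym (visible_store zK Va) (visible_store _ Va) //= !andbT.
by apply: contra_eq_neq hz => ->; rewrite hfree.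
Qed.

Lemma sat_same_content :
  sat s h (FSameContent x y) <-> exists a b, [/\ h.[? s x] = Some a, h.[? s y] = Some b & a = b].
Proof.
rewrite sat_sub; split.
  case=> P /sat_and[/sat_and[ax ay] /sat_sept_one[u [v [hu _ /sat_and[]]]]].
  move=> /sat_reach2[a [xa aS _]] /sat_reach2[b [yb bS _]].
  have [a' hx xa'] := content_unchanged v ax hu; have [b' hy yb'] := content_unchanged v ay hu.
  move: xa yb; rewrite xa' yb' => -[Ea] [Eb]; exists a', b'; split=> //.
  by rewrite Ea Eb (new_cell_into_sink aS) (new_cell_into_sink bS).
case=> a [b [hx hy Eab]]; subst b; exists (predC1 a).
have [_ _ hvis] := Ch; have Va := hvis x a xK hx.
have ha z : 0 < z <= K.+1 -> (filterf h (predC1 a)).[? s z] = h.[? s z].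
  by move=> zK; rewrite fnd_filterf /= visible_store.
split; first by split; apply/sat_alloc; rewrite ha // (hx, hy).
apply/sat_sept_one; exists a, (s 1); split; [by rewrite fnd_filterf /= eqxx | exact: sat_true |].
by split; apply/sat_reach2; exists a; rewrite !fnd_set eqxx (negbTE (visible_store _ Va)) // ha //;
  split=> //; apply: uniq_to_sink.
Qed.

Lemma sat_content_edge : sat s h (FContentEdge x y) <->
  exists a b, [/\ h.[? s x] = Some a, h.[? s y] = Some b & (visgraph h).[? a] = Some b].
Proof.
have [_ _ hvis] := Ch; rewrite sat_sub; split.
  case=> P /sat_and[/sat_and[ax ay] /sat_sept_one[u [v [hu _ /sat_and[]]]]].
  move=> /sat_reach3[a [c [xa ac cS U]]] /sat_reach2[b [yb bS _]].
  have [a' hx xa'] := content_unchanged v ax hu; have [b' hy yb'] := content_unchanged v ay hu.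
  move: xa yb; rewrite xa' yb' => -[Ea] [Eb]; subst a' b'; exists a, b; split=> //.
  move: U; rewrite /= !inE !negb_or => /and4P[_ /andP[/eqP nac _] _ _].
  have Ec : c = b by rewrite (new_cell_into_sink cS) (new_cell_into_sink bS).
  apply/fnd_visgraph; split; last by split; [exact: hvis hx | exact: hvis hy | rewrite -Ec].
  move: ac; rewrite fnd_set -(new_cell_into_sink cS) -Ec; case: eqP => // _.
  by case/fnd_filterf_some.
case=> a [b [hx hy /fnd_visgraph[hab [Va Vb nab]]]]; exists (predC1 b).
have hb z : 0 < z <= K.+1 -> (filterf h (predC1 b)).[? s z] = h.[? s z].
  by move=> zK; rewrite fnd_filterf /= visible_store.
split; first by split; apply/sat_alloc; rewrite hb // (hx, hy).
apply/sat_sept_one; exists b, (s 1); split; [by rewrite fnd_filterf /= eqxx | exact: sat_true |].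
split; [apply/sat_reach3 | apply/sat_reach2].
  exists a, b; rewrite !fnd_set eqxx (negbTE (visible_store _ Vb)) // hb //.
  rewrite (introF eqP nab) fnd_filterf /= (introN eqP nab); split=> //.
  have := uniq_to_sink yK hy; have := uniq_to_sink xK hx.
  rewrite /= !inE !negb_or !andbT => /andP[/andP[-> ->] ->] /andP[_ ->].
  by rewrite visible_store // (introN eqP nab).
exists b; rewrite !fnd_set eqxx (negbTE (visible_store _ Vb)) // hb //.
by split=> //; apply: uniq_to_sink.
Qed.

End Atoms.

Section Translation.
Implicit Types (phi psi : fo).
Variable cmp : nat -> bool -> nat -> nat -> form.

Fixpoint tr l (phi : fo) : form :=
  match phi with
  | FoBot => FNeg FTrue
  | FoEq i j => FSameContent (slot l i) (slot l j)
  | FoEdge i j => FContentEdge (slot l i) (slot l j)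
  | FoInput i => FPto (slot l i) 0
  | FoLeq k i j => cmp l k i j
  | FoAnd p q => FAnd (tr l p) (tr l q)
  | FoOr p q => FOr (tr l p) (tr l q)
  | FoImp p q => FImp (tr l p) (tr l q)
  | FoEx p => FEx l.+2 (tr l.+1 p)
  | FoAll p => FAll l.+2 (tr l.+1 p)
  end.

(* The weight of FoLeq is the number of variables that its translation uses. *)
Fixpoint depth (phi : fo) : nat :=
  match phi with
  | FoBot | FoEq _ _ | FoEdge _ _ | FoInput _ => 0
  | FoLeq _ _ _ => 6
  | FoAnd p q | FoOr p q | FoImp p q => maxn (depth p) (depth q)
  | FoEx p | FoAll p => (depth p).+1
  end.

Variable R : heap -> bool -> LOC -> LOC -> Prop.
Hypothesis sat_cmp : forall h l k i j, config h l -> l + 6 <= K ->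
  sat s h (cmp l k i j) <-> both (slot_env h l) i j (R (visgraph h) k).

Let sat_tr_spec phi := forall h l, config h l -> l + depth phi <= K ->
  sat s h (tr l phi) <-> eval visible (s 0) (R (visgraph h)) (visgraph h) (slot_env h l) phi.

Lemma sat_tr_set h l c phi : sat_tr_spec phi ->
  config h l -> l + (depth phi).+1 <= K -> visible c ->
  sat s h.[s l.+2 <- c] (tr l.+1 phi) <->
  eval visible (s 0) (R (visgraph h)) (visgraph h) (scons c (slot_env h l)) phi.
Proof.
move=> IH Ch lK Vc; rewrite IH; [|by apply: config_set => //; lia | by lia].
by rewrite visgraph_set ?reserved_store //; [apply/eq_eval/slot_env_set|]; lia.
Qed.

Lemma sat_tr h l phi : config h l -> l + depth phi <= K ->
  sat s h (tr l phi) <-> eval visible (s 0) (R (visgraph h)) (visgraph h) (slot_env h l) phi.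
Proof.
elim: phi h l => [|i j|i j|i|k i j|p IHp q IHq|p IHp q IHq|p IHp q IHq|p IHp|p IHp] h l Ch lK;
  have slotK i' : l <= K -> 0 < slot l i' <= K.+1 by (rewrite /slot; lia).
- by split=> // /sat_neg[]; apply: sat_true.
- by rewrite (sat_same_content Ch) -?bothP //; apply: slotK; move: lK => /=; lia.
- by rewrite (sat_content_edge Ch) -?bothP //; apply: slotK; move: lK => /=; lia.
- by [].
- exact: sat_cmp.
- by rewrite sat_and IHp ?IHq //; move: lK => /=; lia.
- by rewrite sat_or IHp ?IHq //; move: lK => /=; lia.
- by rewrite sat_imp IHp ?IHq //; move: lK => /=; lia.
- rewrite (sat_ex _ Ch); last by move: lK => /=; lia.
  by split=> -[c Vc /(sat_tr_set IHp Ch lK Vc)]; exists c.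
- rewrite (sat_all _ Ch); last by move: lK => /=; lia.
  by split=> H c Vc; apply/(sat_tr_set IHp Ch lK Vc)/H.
Qed.

End Translation.

Definition FConfig l :=
  FAnd (FBigAnd [seq FNeg (FAlloc x) | x <- iota 1 K.+1 & (x == 1) || (l.+1 < x)])
    (FAnd (FNotInto l.+2 1) (FBigAnd [seq FImp (FAlloc x) (FVisible x) | x <- iota 1 K.+1])).

Lemma sat_config h l : l < K -> sat s h (FConfig l) <-> config h l.
Proof.
move=> lK; rewrite sat_and sat_and !sat_bigand.
have freeP : (forall x, x \in [seq x <- iota 1 K.+1 | (x == 1) || (l.+1 < x)] ->
    sat s h (FNeg (FAlloc x))) <-> forall x, (x == 1) || (l.+1 < x <= K.+1) -> h.[? s x] = None.
  split=> H x xl; last first.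
    by move/sat_alloc; apply; apply: H; move: xl; rewrite mem_filter mem_iota; lia.
  have /H/sat_neg : x \in [seq x <- iota 1 K.+1 | (x == 1) || (l.+1 < x)].
    by rewrite mem_filter mem_iota; lia.
  by rewrite sat_alloc; case: h.[? s x] => // c [].
have visP : (forall x, x \in iota 1 K.+1 -> sat s h (FImp (FAlloc x) (FVisible x))) <->
    forall x a, 0 < x <= K.+1 -> h.[? s x] = Some a -> visible a.
  split=> H x; [move=> a xK hx | rewrite mem_iota => xK].
    have := H x; rewrite mem_iota sat_imp sat_alloc hx => /(_ xK) Hx.
    exact/(sat_visible hx)/Hx.
  apply/sat_imp => /sat_alloc; case hx: h.[? s x] => [a|//] _.
  exact/(sat_visible hx)/(H x).
have sinkP : (forall x, (x == 1) || (l.+1 < x <= K.+1) -> h.[? s x] = None) ->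
    sat s h (FNotInto l.+2 1) <-> forall u, h.[? u] <> Some (s 1).
  move=> hfree; rewrite sat_notinto; [ | by move/s_inj; lia | by apply: hfree; lia].
  by split=> H u; [case: (u =P s 1) => [->|/H //]; rewrite hfree | move=> _; apply: H].
rewrite freeP visP; split=> [[hfree [/(sinkP hfree) hsink hvis]] | [hfree hsink hvis]]; split=> //.
by split=> //; apply/sinkP.
Qed.

Definition tr_noleq := tr (fun _ _ _ _ => FNeg FTrue).

Lemma sat_tr_noleq h l phi : config h l -> l + depth phi <= K ->
  sat s h (tr_noleq l phi) <->
  eval visible (s 0) (fun _ _ _ => False) (visgraph h) (slot_env h l) phi.
Proof.
apply: (sat_tr (R := fun _ _ _ _ => False)) => {}h {}l k i j _ _.
by rewrite bothP; split=> [/sat_neg[]|[a [b []]] //]; apply: sat_true.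
Qed.

Lemma visgraph_visible h u v : (visgraph h).[? u] = Some v -> visible u /\ visible v.
Proof. by move/visgraphP=> []. Qed.

(* The variables 1 and 0 hold copies of a and b, and a is also the value of the variable i: the
   first part of the heap takes the latter cell, the second part takes the copies. *)
Definition FCut (k : bool) l i :=
  FStar (FAnd (FAlloc (slot l i)) (tr_noleq l (FoFewDeepPreds k i)))
    (FAnd (FAnd (FAlloc (slot l 1)) (FAlloc (slot l 0)))
      (FAnd (tr_noleq l (FoNoPred 1))
        (FSept (FAnd (FAnd (FConfig l.+1) (FAlloc l.+2))
                     (tr_noleq l.+1 (FoAnd (FoNoPred 0) FoInjective)))
               (tr_noleq l.+1 (FoAnd (FoEq 1 0) (FoNear 1)))))).

Section Cut.
Variables (h : heap) (k : bool) (l i : nat) (a b : LOC).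
Hypotheses (l_gt1 : 1 < l) (lK : l + 4 <= K) (i_gt1 : 1 < i) (Ch : config h l).
Hypotheses (env_i : slot_env h l i = Some a) (env_1 : slot_env h l 1 = Some a).
Hypothesis env_0 : slot_env h l 0 = Some b.

Lemma slot_env_filterf P j c : slot_env h l j = Some c ->
  sat s (filterf h P) (FAlloc (slot l j)) <-> slot_env (filterf h P) l j = Some c.
Proof.
by rewrite sat_alloc /slot_env fnd_filterf => hj; case: (P _); split=> //; rewrite hj.
Qed.

Lemma sat_cut_few P : slot_env (filterf h P) l i = Some a ->
  sat s (filterf h P) (tr_noleq l (FoFewDeepPreds k i)) <->
  few_deep_preds k (filterf (visgraph h) P) a.
Proof.
move=> ei; have lK' : l + depth (FoFewDeepPreds k i) <= K by case: (k); rewrite /=; lia.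
rewrite sat_tr_noleq -?visgraph_filterf //; last exact: config_filterf.
by apply: eval_few_deep_preds ei _; apply: visgraph_visible.
Qed.

Lemma sat_cut_no_pred P : slot_env (filterf h P) l 1 = Some a ->
  sat s (filterf h P) (tr_noleq l (FoNoPred 1)) <-> no_pred (filterf (visgraph h) P) a.
Proof.
move=> e1; rewrite sat_tr_noleq -?visgraph_filterf //; [|exact: config_filterf|by rewrite /=; lia].
by apply: eval_no_pred e1; apply: visgraph_visible.
Qed.

Section Added.
Variables (h' : heap) (b' : LOC).
Hypotheses (Ch' : config h' l.+1) (h'l : h'.[? s l.+2] = Some b').

Lemma sat_cut_added : sat s h' (tr_noleq l.+1 (FoAnd (FoNoPred 0) FoInjective)) <->
  no_pred (visgraph h') b' /\ injective_heap (visgraph h').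
Proof.
rewrite sat_tr_noleq //; last by rewrite /=; lia.
have e0 : slot_env h' l.+1 0 = Some b' by [].
have gV := @visgraph_visible h'.
by rewrite eval_and (eval_no_pred _ _ gV e0) eval_injective.
Qed.

Lemma sat_cut_near P : hdisj (filterf h P) h' -> slot_env (filterf h P) l 0 = Some b ->
  sat s (filterf h P + h')%fset (tr_noleq l.+1 (FoAnd (FoEq 1 0) (FoNear 1))) <->
  b = b' /\ near (filterf (visgraph h) P + visgraph h')%fset b.
Proof.
move=> d e0; have C : config (filterf h P + h')%fset l.+1.
  by apply: config_hadd => //; apply/(config_leq (leqnSn l))/config_filterf.
rewrite sat_tr_noleq //; last by rewrite /=; lia.
have e1' : slot_env (filterf h P + h')%fset l.+1 1 = Some b.
  by apply/(fnd_hadd_some _ _ d); left; rewrite -e0 /slot_env /slot subSS.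
have e0' : slot_env (filterf h P + h')%fset l.+1 0 = Some b'.
  by apply/(fnd_hadd_some _ _ d); right.
rewrite eval_and (eval_near _ _ (@visgraph_visible _) e1') -visgraph_filterf -visgraph_hadd //.
by rewrite /= (bothE _ e1' e0').
Qed.

End Added.

Lemma sat_cut : sat s h (FCut k l i) <-> exists P h',
  [/\ slot_env (filterf h P) l i = Some a, slot_env (filterf h (predC P)) l 1 = Some a,
      slot_env (filterf h (predC P)) l 0 = Some b, hdisj (filterf h (predC P)) h' &
      [/\ config h' l.+1, h'.[? s l.+2] = Some b & matching k (visgraph h) a b P (visgraph h')]].
Proof.
have l1K : l.+1 < K by lia.
rewrite sat_star; split=> [[P [/sat_and[]]] | [P [h' [ei e1 e0 d [Ch' h'l]]]]].
  move=> /(slot_env_filterf _ env_i) ei /(sat_cut_few ei) few /sat_and[/sat_and[]].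
  move=> /(slot_env_filterf _ env_1) e1 /(slot_env_filterf _ env_0) e0.
  move=> /sat_and[/(sat_cut_no_pred e1) nop /sat_sept[h' [d /sat_and[/sat_and[]]]]].
  move=> /(sat_config _ l1K) Ch' /sat_alloc; case h'l: h'.[? s l.+2] => [b'|//] _.
  move=> /(sat_cut_added Ch' h'l)[nob inj] /(sat_cut_near Ch' h'l d e0)[Eb near_b].
  rewrite -Eb in h'l nob; exists P, h'; split=> //; split=> //; split=> //.
  by rewrite -visgraph_filterf; apply: hdisj_visgraph.
case=> few nop _ nob [inj near_b]; exists P; split; apply/sat_and; split.
- exact/(slot_env_filterf _ env_i).
- exact/(sat_cut_few ei).
- by apply/sat_and; split; [apply/(slot_env_filterf _ env_1) | apply/(slot_env_filterf _ env_0)].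
apply/sat_and; split; first exact/(sat_cut_no_pred e1).
apply/sat_sept; exists h'; split=> //; last exact/(sat_cut_near Ch' h'l d e0).
apply/sat_and; split; last exact/(sat_cut_added Ch' h'l).
by apply/sat_and; split; [apply/sat_config | apply/sat_alloc; rewrite h'l].
Qed.

Hypothesis ab : comparable_nodes (visgraph h) a b.

Definition spare_copies (P : pred LOC) : pred LOC :=
  fun u => if reserved u then u \notin [:: s (slot l 1); s (slot l 0)] else P u.

Lemma spare_copies_slot P j : spare_copies P (s (slot l j)) = (1 < j).
Proof.
rewrite /spare_copies reserved_store; last by rewrite /slot; lia.
rewrite !inE; apply/norP/idP => [[/eqP n1 /eqP n0] | j1]; first by case: j n1 n0 => [|[|]].
by split; apply/eqP => /s_inj; rewrite /slot; lia.
Qed.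

Lemma spare_copies_visible P u : visible u -> spare_copies P u = P u.
Proof. by rewrite /spare_copies => /negbTE->. Qed.

Lemma matching_spare_copies P g' :
  matching k (visgraph h) a b P g' -> matching k (visgraph h) a b (spare_copies P) g'.
Proof.
have E := @eq_filterf_visgraph h (spare_copies P) P (@spare_copies_visible P).
have EC : filterf (visgraph h) (predC (spare_copies P)) = filterf (visgraph h) (predC P).
  by apply: eq_filterf_visgraph => u Vu /=; rewrite spare_copies_visible.
by rewrite /matching E EC.
Qed.

Lemma sat_cut_of_leq : indeg (visgraph h) a <= indeg (visgraph h) b + k -> sat s h (FCut k l i).
Proof.
have noloop u : (visgraph h).[? u] <> Some u by move=> /visgraphP[].
have [nab _ _] := ab; have [hfree _ hvis] := Ch.
case/(matching_of_indeg_leq noloop nab)=> P [g' [/matching_spare_copies m g'P]].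
have Vb : visible b by apply: hvis env_0; rewrite /slot; lia.
have Gg' : is_visgraph g'.
  move=> u v /g'P[ua vb].
  have [[Vu _] [Vv _]] := (visgraph_visible ua, visgraph_visible vb).
  by split=> // uv; case: nab; move: ua; rewrite uv vb => -[].
have l2_res : reserved (s l.+2) by apply: reserved_store; lia.
apply/sat_cut; exists (spare_copies P), g'.[s l.+2 <- b].
split; try by rewrite /slot_env fnd_filterf /= spare_copies_slot ?i_gt1.
  apply/hdisjP => u; rewrite fnd_set; case: eqP => [->|_].
    by left; rewrite fnd_filterf hfree ?if_same //; lia.
  case g'u: g'.[? u] => [v|]; [left | by right].
  have [_ _ /hdisjP/(_ u) d _ _] := m; have [ua _] := g'P u v g'u.
  move: d; rewrite g'u (fnd_filterf (visgraph h)) ua => -[] //.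
  by rewrite fnd_filterf; case: ifP.
split; [|by rewrite fnd_set eqxx | by rewrite (visgraph_set _ _ l2_res) (visgraph_id Gg')].
by apply: config_set => //; [lia | exact: config_visgraph].
Qed.

Lemma sat_cut_leq : sat s h (FCut k l i) <-> indeg (visgraph h) a <= indeg (visgraph h) b + k.
Proof.
split=> [/sat_cut[P [h' [_ _ _ _ [_ _ m]]]]|]; last exact: sat_cut_of_leq.
exact: indeg_leq_of_matching ab m.
Qed.

End Cut.

Lemma sat_copies h l i j p : config h l -> l + 2 <= K ->
  sat s h (FEx l.+2 (FEx l.+3 (FAnd (tr_noleq l.+2 (FoAnd (FoEq 1 i.+2) (FoEq 0 j.+2))) p))) <->
  exists a b, [/\ slot_env h l i = Some a, slot_env h l j = Some b &
                  sat s h.[s l.+2 <- a].[s l.+3 <- b] p].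
Proof.
move=> Ch lK; have [lK1 lK2] : l < K /\ l.+1 < K by lia.
have [_ _ hvis] := Ch.
have slot_vis x c : slot_env h l x = Some c -> visible c by apply: hvis; rewrite /slot; lia.
have copyP a b : visible a -> visible b ->
    sat s h.[s l.+2 <- a].[s l.+3 <- b] (tr_noleq l.+2 (FoAnd (FoEq 1 i.+2) (FoEq 0 j.+2))) <->
    slot_env h l i = Some a /\ slot_env h l j = Some b.
  move=> Va Vb; have C2 := config_set lK2 Vb (config_set lK1 Va Ch).
  rewrite (sat_tr_noleq C2); last by rewrite /=; lia.
  rewrite /= /both !slot_env_set //= !slot_env_set //=.
  case: (slot_env h l i) => [c|]; case: (slot_env h l j) => [d|]; split=> // -[] //;
    by split; congruence.
rewrite sat_ex //; split=> [[a Va /(sat_ex _ (config_set lK1 Va Ch))[//|b Vb []]] | ].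
  by move=> /(copyP a b Va Vb)[ia jb] pab; exists a, b.
move=> [a [b [ia jb pab]]]; have [Va Vb] := (slot_vis i a ia, slot_vis j b jb).
exists a => //; apply/(sat_ex _ (config_set lK1 Va Ch)) => //; exists b => //.
by split=> //; apply/copyP.
Qed.

Definition leq_nodes (g : heap) (k : bool) a b : Prop :=
  comparable_nodes g a b /\ indeg g a <= indeg g b + k.

Definition FLeq l (k : bool) i j :=
  FAnd (tr_noleq l (FoComparable i j))
    (FEx l.+2 (FEx l.+3
      (FAnd (tr_noleq l.+2 (FoAnd (FoEq 1 i.+2) (FoEq 0 j.+2))) (FCut k l.+2 i.+2)))).

Lemma sat_leq h l k i j : config h l -> l + 6 <= K ->
  sat s h (FLeq l k i j) <-> both (slot_env h l) i j (leq_nodes (visgraph h) k).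
Proof.
move=> Ch lK; rewrite sat_and sat_tr_noleq ?sat_copies ?bothP //; try by rewrite /=; lia.
have [lK1 lK2] : l < K /\ l.+1 < K by lia.
have [_ _ hvis] := Ch.
have slot_vis x c : slot_env h l x = Some c -> visible c by apply: hvis; rewrite /slot; lia.
have cutP a b : slot_env h l i = Some a -> slot_env h l j = Some b ->
    comparable_nodes (visgraph h) a b ->
    sat s h.[s l.+2 <- a].[s l.+3 <- b] (FCut k l.+2 i.+2) <->
    indeg (visgraph h) a <= indeg (visgraph h) b + k.
  move=> ia jb; have [Va Vb] := (slot_vis i a ia, slot_vis j b jb).
  have C2 := config_set lK2 Vb (config_set lK1 Va Ch).
  have -> : visgraph h = visgraph h.[s l.+2 <- a].[s l.+3 <- b].
    by rewrite !visgraph_set // reserved_store //; lia.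
  by apply: sat_cut_leq; rewrite // ?slot_env_set //= ?slot_env_set //; lia.
split=> [[cmp [a [b [ia jb /cutP cut]]]] | [a [b [ia jb [ab le]]]]].
  have ab := (eval_comparable _ _ (@visgraph_visible h) ia jb).1 cmp.
  by exists a, b; split=> //; split=> //; apply: cut.
split; first exact/(eval_comparable _ _ (@visgraph_visible h) ia jb).
by exists a, b; split=> //; apply/cutP.
Qed.

End Embedding.

Definition FDistinct n :=
  FBigAnd [seq FBigAnd [seq FNeg (FEq x y) | x <- iota 0 y] | y <- iota 0 n.+1].

Lemma sat_distinct (s : store) (h : heap) n : sat s h (FDistinct n) <->
  forall x y, x <= n -> y <= n -> s x = s y -> x = y.
Proof.
rewrite sat_bigand; split=> [H x y xn yn sxy | H y].
  have lt_neq u v : u < v -> v <= n -> s u <> s v.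
    move=> uv vn; have := H v; rewrite mem_iota => /(_ vn)/sat_bigand/(_ u).
    by rewrite mem_iota; apply.
  by case: (ltngtP x y) => // lt; [case: (lt_neq _ _ lt yn) | case: (lt_neq _ _ lt xn)].
rewrite mem_iota => yn; apply/sat_bigand => x; rewrite mem_iota => xy.
by move=> /H; lia.
Qed.

Definition fo_cells phi := (depth phi).+1.

Definition FEmbed (phi : fo) : form :=
  FAnd (FDistinct (fo_cells phi).+1)
    (FAnd (FConfig (fo_cells phi) 0)
          (tr (fo_cells phi) (FLeq (fo_cells phi)) 0 phi)).

Lemma sat_embed (s : store) (h : heap) phi (K := fo_cells phi) (g := visgraph s K h) :
  sat s h (FEmbed phi) <->
  [/\ forall x y, x <= K.+1 -> y <= K.+1 -> s x = s y -> x = y, config s K h 0 &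
      eval (visible s K) (s 0) (leq_nodes g) g (fun=> None) phi].
Proof.
have trP : (forall x y, x <= K.+1 -> y <= K.+1 -> s x = s y -> x = y) -> config s K h 0 ->
    sat s h (tr K (FLeq K) 0 phi) <-> eval (visible s K) (s 0) (leq_nodes g) g (fun=> None) phi.
  move=> s_inj Ch; rewrite (sat_tr s_inj (@sat_leq _ _ s_inj) Ch) //.
  by apply: eq_eval => i; have [hfree _ _] := Ch; rewrite /slot_env hfree.
rewrite sat_and sat_distinct sat_and; split=> [[s_inj [C T]] | [s_inj Ch /(trP s_inj Ch) T]].
  have Ch : config s K h 0 by apply/(sat_config s_inj).
  by split=> //; apply/trP.
by split=> //; split=> //; apply/(sat_config s_inj).
Qed.

Definition FNoInput := FNotInto 2 0.
Definition FInputCell := FAnd FOne (FNeg FNoInput).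

Lemma sat_input (s : store) (h : heap) n : s 2 <> s 0 -> h.[? s 2] = None ->
  sat s h (iter n (FStar FInputCell) FNoInput) <->
  size (cells (fun u v => (u != s 0) && (v == s 0)) h) = n.
Proof.
move=> s20 h2; apply: (sat_iter_star (I := fun h => h.[? s 2] = None)) => // {h h2} h.
- by move=> P h2'; rewrite fnd_filterf h2' if_same.
- move=> h2'; rewrite sat_and sat_one sat_neg sat_notinto //.
  split=> [[[u [v ->]] N] | [u [v [-> /andP[/eqP u0 /eqP ->]]]]]; last first.
    split; first by exists u, (s 0).
    by move=> /(_ u u0); rewrite fnd_cell eqxx.
  exists u, v; split=> //; apply: contraT => nuv; case: N => w w0; rewrite fnd_cell.
  by case: eqP => // wu [v0]; rewrite -wu v0 eqxx andbT in nuv; case/negP: nuv; apply/eqP.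
- move=> h2'; rewrite sat_notinto // cells_nil; split=> [H u v huv | H u u0 hu].
    by apply/negP => /andP[/eqP u0 /eqP v0]; apply: (H u u0); rewrite huv v0.
  by have := H u _ hu; rewrite eqxx andbT => /negP; apply; apply/eqP.
Qed.

Lemma sat_input_indeg (s : store) K (h : heap) n : 0 < K ->
  (forall x y, x <= K.+1 -> y <= K.+1 -> s x = s y -> x = y) -> config s K h 0 ->
  sat s h (iter n (FStar FInputCell) FNoInput) <-> indeg (visgraph s K h) (s 0) = n.
Proof.
move=> K_gt0 s_inj [hfree _ _]; rewrite sat_input; [|by move/s_inj; lia|by apply: hfree].
rewrite (size_cells (l := preds (visgraph s K h) (s 0))) ?preds_uniq // => u.
rewrite mem_preds; split=> [/eqP/fnd_visgraph[hu [_ _ u0]] | [v hu /andP[/eqP u0 /eqP v0]]].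
  by exists (s 0); rewrite ?eqxx ?andbT //; apply/eqP.
rewrite v0 in hu; apply/eqP/fnd_visgraph; split=> //; split=> //.
  by apply/negP => /reservedP[x xK ux]; move: hu; rewrite ux hfree //; lia.
by apply/negP => /reservedP[x xK /s_inj]; lia.
Qed.

(** * Inference systems over tuples of numbers *)

(* In a constraint, x and y are indices of facts (0 is the conclusion of the
   rule, the others are its premises) and i, j are indices of their entries. *)
Inductive constr :=
| CEq of nat & nat & nat & nat
| CSucc of nat & nat & nat & nat
| CZero of nat & nat
| CPos of nat & nat.

Definition constr_code c :=
  match c with
  | CEq x i y j => (0, x, i, y, j)
  | CSucc x i y j => (1, x, i, y, j)
  | CZero x i => (2, x, i, 0, 0)
  | CPos x i => (3, x, i, 0, 0)
  end.

Definition constr_decode t :=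
  match t with
  | (0, x, i, y, j) => CEq x i y j
  | (1, x, i, y, j) => CSucc x i y j
  | (2, x, i, _, _) => CZero x i
  | (_, x, i, _, _) => CPos x i
  end.

Lemma constr_codeK : cancel constr_code constr_decode. Proof. by case. Qed.
HB.instance Definition _ := Equality.copy constr (can_type constr_codeK).

Definition rule := seq constr.
Definition clause : Type := nat * seq rule.

Section Systems.
Variables (T : Type) (dom : T -> Prop) (dat : T -> nat -> nat).

Definition holds (e : nat -> T) c : Prop :=
  match c with
  | CEq x i y j => dat (e x) i = dat (e y) j
  | CSucc x i y j => dat (e y) j = (dat (e x) i).+1
  | CZero x i => dat (e x) i = 0
  | CPos x i => 0 < dat (e x) i
  end.

Definition satisfies (e : nat -> T) (r : rule) : Prop := forall c, c \in r -> holds e c.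

Definition rule_holds p (r : rule) : Prop :=
  exists e : nat -> T, [/\ e 0 = p, forall i, dom (e i) & satisfies e r].

(* The entry t of a fact acts as a flag: the clause t applies iff it is 0. *)
Definition supported (cls : seq clause) p : Prop :=
  forall cl, cl \in cls -> dat p cl.1 = 0 -> exists2 r, r \in cl.2 & rule_holds p r.

Definition closed_under (cls : seq clause) : Prop := forall p, dom p -> supported cls p.

End Systems.

Definition facts_of c :=
  match c with CEq x _ y _ | CSucc x _ y _ => maxn x y | CZero x _ | CPos x _ => x end.

Definition entries_of c :=
  match c with CEq _ i _ j | CSucc _ i _ j => maxn i j | CZero _ i | CPos _ i => i end.

Definition rule_facts (r : rule) := \max_(c <- r) facts_of c.

Definition rule_entries (r : rule) := \max_(c <- r) entries_of c.
Definition clause_entries (cl : clause) := maxn cl.1 (\max_(r <- cl.2) rule_entries r).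
Definition system_entries (cls : seq clause) := \max_(cl <- cls) clause_entries cl.

Lemma leq_system_flag (cls : seq clause) cl : cl \in cls -> cl.1 <= system_entries cls.
Proof.
by move=> clc; apply: leq_trans (leq_bigmax_seq (F := clause_entries) _ clc isT); apply: leq_maxl.
Qed.

Lemma leq_system_entries (cls : seq clause) (cl : clause) (r : rule) c :
  cl \in cls -> r \in cl.2 -> c \in r -> entries_of c <= system_entries cls.
Proof.
move=> clc rc cr; apply: leq_trans (leq_bigmax_seq (F := clause_entries) _ clc isT).
apply: leq_trans (leq_maxr _ _); apply: leq_trans (leq_bigmax_seq (F := rule_entries) _ rc isT).
exact: (leq_bigmax_seq (F := entries_of)).
Qed.

(** * Describing a closed set of facts by a formula *)

Definition walk (g : heap) n (u : LOC) : option LOC := iter n (obind (fnd g)) (Some u).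

Lemma walkS g n u : walk g n.+1 u = obind (fnd g) (walk g n u).
Proof. by []. Qed.

Lemma walkSr g n u : walk g n.+1 u = if g.[? u] is Some v then walk g n v else None.
Proof. by rewrite /walk iterSr /=; case: g.[? u] => //=; elim: n => //= n ->. Qed.

Lemma walk_leq g m n u : m <= n -> walk g n u -> walk g m u.
Proof.
move=> /subnKC <-; rewrite /walk addnC iterD.
have stuck k : iter k (obind (fnd g)) None = None by elim: k => //= k ->.
by case: (iter m _ _); rewrite ?stuck.
Qed.

(* The entries of a fact sit at distance 3, 5, 7, ... from its first node: then no entry is a
   predecessor of another one, and the nodes that point to an entry from outside the chain do not
   start walks as long as the whole chain. *)
Definition position i := i.*2 + 3.

Section Facts.
Variables (g : heap) (M : nat).

Definition fact p : bool := walk g (position M) p.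
Definition entry_node p i : LOC := odflt 0 (walk g (position i) p).

(* The predecessor in the chain is not counted. *)
Definition entry p i : nat := (indeg g (entry_node p i)).-1.

Definition is_entry_node a : Prop :=
  exists p i, [/\ fact p, i <= M & walk g (position i) p = Some a].

Definition separated : Prop :=
  forall a b, is_entry_node a -> is_entry_node b -> a = b \/ comparable_nodes g a b.

Lemma walk_entry p i : fact p -> i <= M -> walk g (position i) p = Some (entry_node p i).
Proof.
move=> Fp iM; have : walk g (position i) p.
  by apply: walk_leq Fp; rewrite /position leq_add2r leq_double.
by rewrite /entry_node; case: walk.
Qed.

Lemma entry_nodeP p i : fact p -> i <= M -> is_entry_node (entry_node p i).
Proof. by move=> Fp iM; exists p, i; rewrite walk_entry. Qed.

Lemma indeg_entry_node a : is_entry_node a -> 0 < indeg g a.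
Proof.
case=> p [i [_ _]]; rewrite /position addn3 walkS; case: walk => //= u ua.
have : u \in preds g a by rewrite mem_preds ua.
by rewrite /indeg; case: (preds g a).
Qed.

Lemma entryK p i : fact p -> i <= M -> indeg g (entry_node p i) = (entry p i).+1.
Proof. by move=> Fp iM; rewrite prednK //; apply/indeg_entry_node/entry_nodeP. Qed.

End Facts.

Fixpoint FoPath n i j :=
  if n is n'.+1 then FoEx (FoAnd (FoEdge i.+1 0) (FoPath n' 0 j.+1)) else FoEq i j.

Fixpoint FoChain n i :=
  if n is n'.+1 then FoEx (FoAnd (FoEdge i.+1 0) (FoChain n' 0)) else FoEq i i.

Definition FoBigAnd (l : seq fo) := foldr FoAnd (FoNeg FoBot) l.
Definition FoBigOr (l : seq fo) := foldr FoOr FoBot l.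

(* FoLeq only relates distinct nodes. *)
Definition FoEqN i j := FoOr (FoEq i j) (FoAnd (FoLeq false i j) (FoLeq false j i)).
Definition FoSuccN i j := FoAnd (FoLeq true j i) (FoNeg (FoLeq false j i)).
Definition FoZeroN i := FoEx (FoAnd (FoEdge 0 i.+1) (FoAll (FoImp (FoEdge 0 i.+2) (FoEq 1 0)))).

Definition FoAtEntry i x phi := FoEx (FoAnd (FoPath (position i) x.+1 0) phi).

(* f maps the indices of facts to variables. *)
Definition FoConstr (f : nat -> nat) c :=
  match c with
  | CEq x i y j => FoAtEntry i (f x) (FoAtEntry j (f y).+1 (FoEqN 1 0))
  | CSucc x i y j => FoAtEntry i (f x) (FoAtEntry j (f y).+1 (FoSuccN 1 0))
  | CZero x i => FoAtEntry i (f x) (FoZeroN 0)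
  | CPos x i => FoAtEntry i (f x) (FoNeg (FoZeroN 0))
  end.

Section Formulas.
Variable M : nat.

Definition FoFact i := FoChain (position M) i.

Definition FoExFacts n phi := iter n (fun psi => FoEx (FoAnd (FoFact 0) psi)) phi.

(* After the conclusion and the n premises have been introduced, fact x is the variable n - x. *)
Definition FoRule (r : rule) :=
  FoExFacts (rule_facts r) (FoBigAnd [seq FoConstr (subn (rule_facts r)) c | c <- r]).

Definition FoFlag t := FoConstr id (CZero 0 t).

Definition FoClause (cl : clause) :=
  FoAll (FoImp (FoFact 0) (FoImp (FoFlag cl.1) (FoBigOr (map FoRule cl.2)))).

Definition FoIsEntry i :=
  FoEx (FoAnd (FoFact 0) (FoBigOr [seq FoPath (position k) 0 i.+1 | k <- iota 0 M.+1])).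

Definition FoSeparated :=
  FoAll (FoAll (FoImp (FoIsEntry 1) (FoImp (FoIsEntry 0) (FoOr (FoEq 1 0) (FoComparable 1 0))))).

Definition FoInputFact t i :=
  FoEx (FoAnd (FoFact 0) (FoAnd (FoFlag t) (FoAtEntry i 0 (FoInput 0)))).

Definition FoSystem (cls : seq clause) t i :=
  FoAnd FoSeparated (FoAnd (FoBigAnd (map FoClause cls)) (FoInputFact t i)).

Section Semantics.
Variables (V : pred LOC) (input : LOC) (g : heap).
Hypothesis gV : forall u v, g.[? u] = Some v -> V u /\ V v.

Local Notation ev := (eval V input (leq_nodes g) g).

Lemma eval_bigand (A : eqType) env (l : seq A) F :
  ev env (FoBigAnd (map F l)) <-> forall x, x \in l -> ev env (F x).
Proof.
elim: l => [|x l IH] /=; first by split=> // _ [].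
split=> [[Fx /IH Fl] y | Fl]; first by rewrite inE => /predU1P[->|/Fl].
by split; [|apply/IH => y yl]; apply: Fl; rewrite inE ?eqxx ?yl ?orbT.
Qed.

Lemma eval_bigor (A : eqType) env (l : seq A) F :
  ev env (FoBigOr (map F l)) <-> exists2 x, x \in l & ev env (F x).
Proof.
elim: l => [|x l IH] /=; first by split=> // -[].
split=> [[Fx | /IH[y yl Fy]] | [y]].
- by exists x; rewrite ?mem_head.
- by exists y; rewrite ?inE ?yl ?orbT.
by rewrite inE => /predU1P[-> Fx | yl Fy]; [left | right; apply/IH; exists y].
Qed.

Lemma eval_path n env i j a b : env i = Some a -> env j = Some b ->
  ev env (FoPath n i j) <-> walk g n a = Some b.
Proof.
elim: n env i j a => [|n IH] env i j a ia jb.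
  by rewrite /= (bothE _ ia jb); split=> [->|[]].
rewrite walkSr eval_ex; split=> [[c _ /eval_and[]] | ].
  by rewrite /= /both /= ia => -> /(IH (scons c env) 0 j.+1 c erefl jb).
case ac: g.[? a] => [c|//] cb; exists c; first by case: (gV ac).
apply/eval_and; split; first by rewrite /= /both /= ia.
exact/(IH (scons c env) 0 j.+1 c erefl jb).
Qed.

Lemma eval_chain n env i a : env i = Some a -> ev env (FoChain n i) <-> walk g n a.
Proof.
elim: n env i a => [|n IH] env i a ia; first by rewrite /= (bothE _ ia ia).
rewrite walkSr eval_ex; split=> [[c _ /eval_and[]] | ].
  by rewrite /= /both /= ia => -> /(IH (scons c env) 0 c erefl).
case ac: g.[? a] => [c|//] cb; exists c; first by case: (gV ac).
apply/eval_and; split; first by rewrite /= /both /= ia.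
exact/(IH (scons c env) 0 c erefl).
Qed.

Lemma walk_visible n u v : walk g n u = Some v -> 0 < n -> V u /\ V v.
Proof.
case: n => // n E _; split.
  by move: E; rewrite walkSr; case uw: g.[? u] => [w|//] _; case: (gV uw).
by move: E; rewrite walkS; case: walk => //= w /gV[].
Qed.

Lemma fact_visible p : fact g M p -> V p.
Proof.
rewrite /fact; case E: walk => [u|//] _.
by have [] := walk_visible E _; rewrite // /position addn3.
Qed.

Lemma eval_fact env i p : env i = Some p -> ev env (FoFact i) <-> fact g M p.
Proof. exact: eval_chain. Qed.

Lemma eval_at_entry env i x p phi : env x = Some p -> fact g M p -> i <= M ->
  ev env (FoAtEntry i x phi) <-> ev (scons (entry_node g p i) env) phi.
Proof.
move=> xp Fp iM; have E := walk_entry Fp iM.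
have pathP c := @eval_path (position i) (scons c env) x.+1 0 p c xp erefl.
rewrite eval_ex; split=> [[c _ /eval_and[/pathP]] | phi_i]; first by rewrite E => -[->].
exists (entry_node g p i); first by have [] := walk_visible E _; rewrite // /position addn3.
by apply/eval_and; split=> //; apply/pathP.
Qed.

Lemma eval_zeroN env i a : env i = Some a -> ev env (FoZeroN i) <-> indeg g a = 1.
Proof.
move=> ia; rewrite /= /both /= ia; split=> [[u _ [ua H]] | ].
  apply: (size_cells (l := [:: u])) => // v; rewrite inE; split=> [/eqP-> | [w vw /eqP wa]].
    by exists a.
  by rewrite wa in vw; rewrite (H v) //; case: (gV vw).
rewrite /indeg; case E: (preds g a) => [|u []] // _.
have ua : g.[? u] = Some a by apply/eqP; rewrite -mem_preds E mem_head.
exists u; first by case: (gV ua).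
by split=> // v _ va; apply/esym/eqP; rewrite -mem_seq1 -E mem_preds va.
Qed.

Lemma eval_is_entry env i a : env i = Some a -> ev env (FoIsEntry i) <-> is_entry_node g M a.
Proof.
move=> ia; rewrite eval_ex; split=> [[p _ /eval_and[/(@eval_fact _ 0 p erefl) Fp]] | ].
  case/eval_bigor=> k; rewrite mem_iota => kM /(@eval_path _ _ 0 i.+1 p a erefl ia) pa.
  by exists p, k.
case=> p [k [Fp kM pa]]; exists p; first exact: fact_visible.
apply/eval_and; split; first exact/(@eval_fact (scons p env) 0 p erefl).
apply/eval_bigor; exists k; first by rewrite mem_iota.
exact/(@eval_path _ (scons p env) 0 i.+1 p a erefl ia).
Qed.

Lemma is_entry_visible a : is_entry_node g M a -> V a.
Proof.
by case=> p [i [_ _ pa]]; have [] := walk_visible pa _; rewrite // /position addn3.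
Qed.

Lemma eval_separated env : ev env FoSeparated <-> separated g M.
Proof.
have bodyP a b : ev (scons b (scons a env))
    (FoImp (FoIsEntry 1) (FoImp (FoIsEntry 0) (FoOr (FoEq 1 0) (FoComparable 1 0)))) <->
    (is_entry_node g M a -> is_entry_node g M b -> a = b \/ comparable_nodes g a b).
  have orP : ev (scons b (scons a env)) (FoOr (FoEq 1 0) (FoComparable 1 0)) <->
      a = b \/ comparable_nodes g a b.
    by rewrite eval_or (@eval_comparable _ _ _ _ gV (scons b (scons a env)) 1 0 a b).
  by rewrite !eval_imp (@eval_is_entry _ 1 a) // (@eval_is_entry _ 0 b) // orP.
rewrite eval_all; split=> [H a b Ea Eb | H a _]; last by apply/eval_all => b _; apply/bodyP/H.
have /eval_all/(_ b (is_entry_visible Eb))/bodyP := H a (is_entry_visible Ea).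
exact.
Qed.

Section Separated.
Hypothesis sep : separated g M.

Section Numbers.
Variables (env : fo_env) (i j : nat) (a b : LOC).
Hypotheses (ia : env i = Some a) (jb : env j = Some b).
Hypotheses (Ea : is_entry_node g M a) (Eb : is_entry_node g M b).

Lemma eval_eqN : ev env (FoEqN i j) <-> indeg g a = indeg g b.
Proof.
rewrite /= !(bothE _ ia jb) (bothE _ jb ia) /leq_nodes !addn0.
split=> [[->|[[_ le] [_ ge]]] // | E]; first by apply/eqP; rewrite eqn_leq le.
case: (sep Ea Eb) => [|ab]; first by left.
by case: (sep Eb Ea) => [->|ba]; [left | right; rewrite E].
Qed.

Lemma eval_succN : ev env (FoSuccN i j) <-> indeg g b = (indeg g a).+1.
Proof.
rewrite /= !(bothE _ jb ia) /leq_nodes addn0 addn1; split=> [[[ba le] N] | E].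
  by apply/eqP; rewrite eqn_leq le ltnNge; apply/negP => le'; apply: N.
rewrite E ltnn; split=> [|[]//]; split=> //.
by case: (sep Eb Ea) => // ba; move: E; rewrite ba => /n_Sn.
Qed.

End Numbers.

Lemma eval_constr env f e c :
  (forall x, x <= facts_of c -> env (f x) = Some (e x)) -> (forall x, fact g M (e x)) ->
  entries_of c <= M -> ev env (FoConstr f c) <-> holds (entry g) e c.
Proof.
move=> fe Fe.
have En x k : k <= M -> is_entry_node g M (entry_node g (e x) k) by apply: entry_nodeP.
have nodeK x k : k <= M -> indeg g (entry_node g (e x) k) = (entry g (e x) k).+1.
  by apply: entryK.
case: c fe => [x i y j|x i y j|x i|x i] fe; cbn [entries_of FoConstr holds]; rewrite ?geq_max.
- move=> /andP[iM jM]; have [ex ey] := (fe x (leq_maxl _ _), fe y (leq_maxr _ _)).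
  rewrite (eval_at_entry _ ex) // (eval_at_entry _ (p := e y)) //.
  rewrite (eval_eqN (a := entry_node g (e x) i) (b := entry_node g (e y) j)) ?nodeK //; auto.
  by split=> [[]|->].
- move=> /andP[iM jM]; have [ex ey] := (fe x (leq_maxl _ _), fe y (leq_maxr _ _)).
  rewrite (eval_at_entry _ ex) // (eval_at_entry _ (p := e y)) //.
  rewrite (eval_succN (a := entry_node g (e x) i) (b := entry_node g (e y) j)) ?nodeK //; auto.
  by split=> [[]|->].
- move=> iM; rewrite (eval_at_entry _ (fe x (leqnn _))) //.
  by rewrite (eval_zeroN (a := entry_node g (e x) i)) ?nodeK //; split=> [[]|->].
- move=> iM; rewrite (eval_at_entry _ (fe x (leqnn _))) // lt0n.
  rewrite eval_imp (eval_zeroN (a := entry_node g (e x) i)) ?nodeK //.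
  by split=> [N | /eqP N []//]; apply/eqP => E; apply: N; rewrite E.
Qed.

(* The variable 0 of env and n further variables denote e 0, ..., e n. *)
Definition extend n (e : nat -> LOC) (env : fo_env) : fo_env :=
  fun i => if i <= n then Some (e (n - i)) else env (i - n).

Lemma extendS n e env : extend n.+1 e env =1 scons (e n.+1) (extend n e env).
Proof. by case=> [|i]; rewrite /extend /= ?subSS. Qed.

Lemma eq_extend n e e' env :
  (forall i, i <= n -> e i = e' i) -> extend n e env =1 extend n e' env.
Proof. by move=> E i; rewrite /extend E ?leq_subr. Qed.

Lemma eval_ex_facts n env p phi : env 0 = Some p -> fact g M p ->
  ev env (FoExFacts n phi) <->
  exists e, [/\ e 0 = p, forall i, fact g M (e i) & ev (extend n e env) phi].
Proof.
move=> env0 Fp; elim: n phi => [|n IH] phi.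
  have E e : e 0 = p -> extend 0 e env =1 env by move=> ep [|i]; rewrite /extend /= ?subn0 ?ep.
  split=> [phi_p | [e [ep _]]]; last by move/(eq_eval _ _ _ _ _ (E e ep)).
  by exists (fun=> p); split=> //; apply/(eq_eval _ _ _ _ _ (E (fun=> p) erefl)).
rewrite /FoExFacts iterSr -/(FoExFacts _ _) IH.
split=> [[e [e0 Fe /eval_ex[c _ /eval_and[Fc phi_c]]]] | [e [e0 Fe phi_e]]].
  pose e' i := if i <= n then e i else c.
  have E : extend n.+1 e' env =1 scons c (extend n e env).
    by case=> [|i]; rewrite extendS /e' ?ltnn //=; apply: eq_extend => j ->.
  exists e'; split=> // [i|]; last exact/(eq_eval _ _ _ _ _ E).
  by rewrite /e'; case: ifP => // _; move/(@eval_fact _ 0 c erefl): Fc.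
exists e; split=> //; apply/eval_ex; exists (e n.+1); first exact: fact_visible.
apply/eval_and; split; first exact/(@eval_fact (scons _ _) 0 _ erefl).
exact/(eq_eval _ _ _ _ _ (extendS n e env)).
Qed.

Lemma eval_rule env p r : env 0 = Some p -> fact g M p ->
  (forall c, c \in r -> entries_of c <= M) ->
  ev env (FoRule r) <-> rule_holds (fact g M) (entry g) p r.
Proof.
move=> env0 Fp rM; rewrite (eval_ex_facts _ _ env0 Fp).
have rP e c : (forall i, fact g M (e i)) -> c \in r ->
    ev (extend (rule_facts r) e env) (FoConstr (subn (rule_facts r)) c) <-> holds (entry g) e c.
  move=> Fe cr; apply: eval_constr => // [x xc | ]; last exact: rM.
  have xr : x <= rule_facts r by apply: leq_trans xc (leq_bigmax_seq (F := facts_of) _ cr isT).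
  by rewrite /extend leq_subr subKn.
split=> -[e [e0 Fe H]]; exists e; split=> //.
  by move=> c cr; apply/rP => //; apply: (eval_bigand _ _ _).1 H c cr.
by apply/eval_bigand => c cr; apply/rP => //; apply: H.
Qed.

Lemma eval_flag env p t : env 0 = Some p -> fact g M p -> t <= M ->
  ev env (FoFlag t) <-> entry g p t = 0.
Proof. by move=> env0 Fp tM; apply: (eval_constr (e := fun=> p)) => // -[]. Qed.

Lemma eval_clause env (cl : clause) : cl.1 <= M ->
  (forall r c, r \in cl.2 -> c \in r -> entries_of c <= M) ->
  ev env (FoClause cl) <-> forall p, fact g M p -> entry g p cl.1 = 0 ->
    exists2 r, r \in cl.2 & rule_holds (fact g M) (entry g) p r.
Proof.
move=> tM rM.
have bodyP p : fact g M p -> ev (scons p env) (FoImp (FoFlag cl.1) (FoBigOr (map FoRule cl.2))) <->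
    (entry g p cl.1 = 0 -> exists2 r, r \in cl.2 & rule_holds (fact g M) (entry g) p r).
  move=> Fp; rewrite -[ev _ _]/(ev _ (FoFlag cl.1) -> ev _ (FoBigOr _)).
  rewrite (eval_flag (p := p)) // eval_bigor.
  have ruleP r : r \in cl.2 ->
      ev (scons p env) (FoRule r) <-> rule_holds (fact g M) (entry g) p r.
    by move=> rc; apply: eval_rule => // c; apply: rM.
  by split=> H /H[r rc] /(ruleP r rc); exists r.
rewrite eval_all; split=> [H p Fp | H p _]; last first.
  by apply/eval_imp => /(@eval_fact (scons p env) 0 p erefl) Fp; apply/bodyP/H.
apply/bodyP => //; have /eval_imp := H p (fact_visible Fp); apply.
exact/(@eval_fact (scons p env) 0 p erefl).
Qed.

Lemma eval_clauses env cls : system_entries cls <= M ->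
  ev env (FoBigAnd (map FoClause cls)) <-> closed_under (fact g M) (entry g) cls.
Proof.
move=> clsM; rewrite eval_bigand.
have clauseP cl : cl \in cls -> ev env (FoClause cl) <-> forall p, fact g M p ->
    entry g p cl.1 = 0 -> exists2 r, r \in cl.2 & rule_holds (fact g M) (entry g) p r.
  move=> clc; apply: eval_clause => [|r c rc cr]; apply: leq_trans clsM.
    exact: leq_system_flag.
  exact: (leq_system_entries clc rc cr).
split=> [H p Fp cl clc | H cl clc]; first exact: ((clauseP cl clc).1 (H cl clc) p Fp).
by apply/(clauseP cl clc) => p Fp; apply: H.
Qed.

Lemma eval_input_fact env t i : t <= M -> i <= M ->
  ev env (FoInputFact t i) <->
  exists p, [/\ fact g M p, entry g p t = 0 & entry_node g p i = input].
Proof.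
move=> tM iM.
have bodyP p : fact g M p -> ev (scons p env) (FoAnd (FoFlag t) (FoAtEntry i 0 (FoInput 0))) <->
    entry g p t = 0 /\ entry_node g p i = input.
  move=> Fp; rewrite eval_and (eval_flag (p := p)) // (eval_at_entry _ (p := p)) //.
  by rewrite /=; split=> [[-> [->]] | [-> ->]].
rewrite eval_ex; split=> [[p _ /eval_and[]] | [p [Fp pt pi]]].
  by move=> /(@eval_fact _ 0 p erefl) Fp /(bodyP p Fp)[pt pi]; exists p.
exists p; first exact: fact_visible.
by apply/eval_and; split; [apply/(@eval_fact (scons p env) 0 p erefl) | apply/bodyP].
Qed.

End Separated.

Lemma eval_system env cls t i : system_entries cls <= M -> t <= M -> i <= M ->
  ev env (FoSystem cls t i) <->
  [/\ separated g M, closed_under (fact g M) (entry g) cls &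
      exists p, [/\ fact g M p, entry g p t = 0 & entry_node g p i = input]].
Proof.
move=> clsM tM iM; rewrite eval_and eval_separated eval_and.
by split=> [[sep []] | [sep C H]]; rewrite ?(eval_clauses sep) ?(eval_input_fact sep).
Qed.

End Semantics.

End Formulas.

Definition system_bound (cls : seq clause) t i := maxn (system_entries cls) (maxn t i).

Definition FSystem cls t i := FEmbed (FoSystem (system_bound cls t i) cls t i).

Lemma system_bounds cls t i (M := system_bound cls t i) :
  [/\ system_entries cls <= M, t <= M & i <= M].
Proof. by rewrite /M /system_bound; split; lia. Qed.

Lemma system_sound (s : store) (h : heap) cls t i n :
  sat s h (FSystem cls t i) -> sat s h (iter n.+1 (FStar FInputCell) FNoInput) ->
  exists (dom : LOC -> Prop) dat, closed_under dom dat cls /\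
    exists p, [/\ dom p, dat p t = 0 & dat p i = n].
Proof.
have [clsM tM iM] := system_bounds cls t i.
case/sat_embed=> s_inj Ch /(eval_system _ (@visgraph_visible s _ h) _ clsM tM iM).
case=> _ C [p [Fp pt pi]] Hn.
set M := system_bound cls t i in Fp C *; set g := visgraph _ _ _ in pi pt C Fp.
exists (fact g M), (entry g); split=> //; exists p; split=> //.
by apply: succn_inj; rewrite -(entryK Fp iM) pi; apply/(sat_input_indeg _ _ s_inj Ch).
Qed.

(** * A heap that represents a finite set of facts *)

(* The fact i is the walk along Chain i 0, Chain i 1, ...; the predecessors outside the chain of
   the node of its entry a are the nodes Leg i a l, each of which has the predecessor Tip i a l. *)
Inductive node :=
| Chain of nat & nat
| Leg of nat & nat & nat
| Tip of nat & nat & nat.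

Definition node_code x :=
  match x with
  | Chain i j => (0, i, j, 0)
  | Leg i a l => (1, i, a, l)
  | Tip i a l => (2, i, a, l)
  end.

Definition node_decode c :=
  match c with
  | (0, i, j, _) => Chain i j
  | (1, i, a, l) => Leg i a l
  | (_, i, a, l) => Tip i a l
  end.

Lemma node_codeK : cancel node_code node_decode. Proof. by case. Qed.
HB.instance Definition _ := Countable.copy node (can_type node_codeK).

Definition loc (x : node) : LOC := (choice.pickle x).*2.+1.

Lemma loc_inj : injective loc.
Proof. by move=> x y [] /double_inj; apply: (pcan_inj choice.pickleK). Qed.

Section Model.
Variables (N M : nat) (dat : nat -> nat -> nat).

Definition next (x : node) : option node :=
  match x with
  | Chain i j => if (i < N) && (j < position M) then Some (Chain i j.+1) else None
  | Leg i a l => if [&& i < N, a <= M & l < dat i a] then Some (Chain i (position a)) else None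
  | Tip i a l => if [&& i < N, a <= M & l < dat i a] then Some (Leg i a l) else None
  end.

Definition entry_indices := [seq (i, a) | i <- iota 0 N, a <- iota 0 M.+1].

Definition nodes : seq node :=
  [seq Chain i j | i <- iota 0 N, j <- iota 0 (position M)] ++
  [seq Leg p.1 p.2 l | p <- entry_indices, l <- iota 0 (dat p.1 p.2)] ++
  [seq Tip p.1 p.2 l | p <- entry_indices, l <- iota 0 (dat p.1 p.2)].

Lemma mem_nodes x : next x -> x \in nodes.
Proof.
have ia i a : i < N -> a <= M -> (i, a) \in entry_indices.
  by move=> iN aM; rewrite allpairs_f ?mem_iota.
rewrite /nodes !mem_cat; case: x => [i j|i a l|i a l] /=; case: ifP => //.
- by move=> /andP[iN jM] _; rewrite allpairs_f ?mem_iota.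
- move=> /and3P[iN aM ld] _; apply/or3P/Or32/allpairsPdep.
  by exists (i, a), l; rewrite ia ?mem_iota.
- move=> /and3P[iN aM ld] _; apply/or3P/Or33/allpairsPdep.
  by exists (i, a), l; rewrite ia ?mem_iota.
Qed.

Definition model : heap :=
  heap_of (map loc nodes) (fun u => obind (fun x => omap loc (next x)) (choice.unpickle u./2)).

Lemma fnd_model x : model.[? loc x] = omap loc (next x).
Proof.
rewrite fnd_heap_of (mem_map loc_inj) /loc (half_bit_double _ true) choice.pickleK /=.
by case: ifP => //; case nx: (next x) => // /negP[]; apply: mem_nodes; rewrite nx.
Qed.

Lemma model_edge u v : model.[? u] = Some v ->
  exists x y, [/\ u = loc x, v = loc y & next x = Some y].
Proof.
rewrite {1}fnd_heap_of; case: ifP => // /mapP[x _ ->].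
rewrite /loc (half_bit_double _ true) choice.pickleK /=; case nx: (next x) => [y|] //= [<-].
by exists x, y.
Qed.

Lemma model_pred u y : model.[? u] = Some (loc y) <-> exists2 x, u = loc x & next x = Some y.
Proof.
split=> [/model_edge[x [y' [-> /loc_inj-> nx]]] | [x -> nx]]; first by exists x.
by rewrite fnd_model nx.
Qed.

Lemma next_neq x y : next x = Some y -> x <> y.
Proof.
by case: x => [i j|i a l|i a l] /=; case: ifP => // _ [<-] // [] /n_Sn.
Qed.

Lemma next_chain x i j : next x = Some (Chain i j) -> i < N /\
  ((exists2 j', x = Chain i j' & j = j'.+1) \/
   exists a l, [/\ x = Leg i a l, j = position a, a <= M & l < dat i a]).
Proof.
case: x => [i' j'|i' a l|i' a l] /=; case: ifP => //.
  by move=> /andP[iN _] [<- <-]; split=> //; left; exists j'.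
by move=> /and3P[iN aM ld] [<- <-]; split=> //; right; exists a, l.
Qed.

Lemma walk_chain n i j : i < N -> j + n <= position M ->
  walk model n (loc (Chain i j)) = Some (loc (Chain i (j + n))).
Proof.
move=> iN; elim: n j => [|n IH] j le; first by rewrite addn0.
by rewrite walkSr fnd_model /= iN (leq_trans _ le) /= ?IH ?addSnnS // addnS ltnS leq_addr.
Qed.

Lemma walk_chain_leq n i j : walk model n.+1 (loc (Chain i j)) -> i < N /\ j + n < position M.
Proof.
elim: n j => [|n IH] j; rewrite walkSr fnd_model /=; case: ifP => // /andP[iN jM].
  by rewrite addn0.
by move=> /IH[_]; rewrite addSnnS.
Qed.

Lemma fact_model p : fact model M p <-> exists2 i, i < N & p = loc (Chain i 0).
Proof.
split=> [|[i iN ->]]; last by rewrite /fact walk_chain.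
rewrite /fact; have posM : position M = (M.*2).+3 by rewrite /position addn3.
rewrite {1}posM walkSr; case E: model.[? p] => [v|//].
have [x [y [-> -> nx]]] := model_edge E.
case: x nx => [i j|i a l|i a l]; rewrite /next; case: ifP => // /andP[iN _] [<-].
- by move=> /walk_chain_leq[_ ?]; exists i; rewrite //; congr loc; congr Chain; lia.
- by move=> /walk_chain_leq[_]; rewrite posM /position; lia.
- rewrite walkSr fnd_model /next; case: ifP => // _ /walk_chain_leq[_].
  by rewrite posM /position; lia.
Qed.

Lemma leq_position a : a <= M -> position a <= position M.
Proof. by move=> aM; rewrite /position leq_add2r leq_double. Qed.

Lemma entry_node_model i a : i < N -> a <= M ->
  entry_node model (loc (Chain i 0)) a = loc (Chain i (position a)).
Proof. by move=> iN aM; rewrite /entry_node walk_chain // leq_position. Qed.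

Lemma indeg_model i a : i < N -> a <= M ->
  indeg model (loc (Chain i (position a))) = (dat i a).+1.
Proof.
move=> iN aM; pose l := Chain i (a.*2 + 2) :: [seq Leg i a k | k <- iota 0 (dat i a)].
have -> : (dat i a).+1 = size (map loc l) by rewrite size_map /= size_map size_iota.
apply: size_cells => [|u].
  rewrite map_inj_uniq ?map_inj_uniq //=; [|exact: loc_inj].
  rewrite map_inj_uniq ?iota_uniq ?andbT; last by move=> k k' [].
  by apply/mapP => -[].
split=> [/mapP[x xl ->] | [v uv /eqP Ev]].
  exists (loc (Chain i (position a))) => //; rewrite fnd_model.
  move: xl; rewrite inE => /predU1P[->|/mapP[k]] /=.
    by rewrite iN /= /position addn3 addn2 addn3 !ltnS leq_double aM.
  by rewrite mem_iota => /= kd ->; rewrite /= iN aM kd.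
move: uv; rewrite Ev => /model_pred[x -> /next_chain[_ [[j' -> Ej] | [a' [k [-> Ea _ kd]]]]]].
  have -> : j' = a.*2 + 2 by rewrite /position in Ej; lia.
  by rewrite (mem_map loc_inj) mem_head.
have Ea' : a' = a by rewrite /position in Ea; lia.
rewrite Ea' in kd *; rewrite (mem_map loc_inj) inE; apply/orP; right.
by rewrite map_f // mem_iota.
Qed.

Lemma entry_model i a : i < N -> a <= M -> entry model (loc (Chain i 0)) a = dat i a.
Proof. by move=> iN aM; rewrite /entry entry_node_model // indeg_model. Qed.

Lemma separated_model : separated model M.
Proof.
move=> u v [p [a [/fact_model[i iN ->] aM]]].
rewrite walk_chain ?leq_position // => -[<-] [q [b [/fact_model[j jN ->] bM]]].
rewrite walk_chain ?leq_position // => -[<-]; rewrite !add0n {u v p q}.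
have [->|ne] := eqVneq (Chain i (position a)) (Chain j (position b)); [by left|right].
split=> [/loc_inj/eqP | /model_pred[x /loc_inj<- /next_chain[_]] | u]; first by apply/negP.
  by case=> [[j' [_ <-]] | [a' [l []]]] //; rewrite /position; lia.
move=> /model_pred[x -> /next_chain[_ [[j' -> Ej] | [a' [l [-> _ aM' ld]]]]]].
  exists (loc (Chain i (a.*2 + 1))); apply/model_pred; exists (Chain i (a.*2 + 1)) => //=.
  rewrite iN /= ifT; last by rewrite /position; lia.
  by congr (Some (Chain _ _)); rewrite /position in Ej; lia.
exists (loc (Tip i a' l)); apply/model_pred; exists (Tip i a' l) => //=.
by rewrite iN aM' ld.
Qed.

Lemma closed_model cls : system_entries cls <= M ->
  closed_under (fun i => i < N) dat cls -> closed_under (fact model M) (entry model) cls.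
Proof.
move=> clsM C _ /fact_model[i iN ->] cl clc; rewrite entry_model //; last first.
  exact: leq_trans (leq_system_flag clc) clsM.
case/(C i iN cl clc)=> r rc [e [e0 eN er]]; exists r => //.
exists (fun x => loc (Chain (e x) 0)); split=> [|x|c cr]; first by rewrite e0.
  by apply/fact_model; exists (e x).
have := leq_trans (leq_system_entries clc rc cr) clsM; have := er c cr.
case: c {cr} => [x a y b|x a y b|x a|x a] /=; rewrite ?geq_max => H.
- by move=> /andP[aM bM]; rewrite !entry_model.
- by move=> /andP[aM bM]; rewrite !entry_model.
- by move=> aM; rewrite entry_model.
- by move=> aM; rewrite entry_model.
Qed.

End Model.

Lemma system_complete (cls : seq clause) t i N dat p n :
  closed_under (fun q => q < N) dat cls -> p < N -> dat p t = 0 -> dat p i = n ->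
  exists (s : store) (h : heap),
    sat s h (FSystem cls t i) /\ sat s h (iter n.+1 (FStar FInputCell) FNoInput).
Proof.
move=> C pN pt <-; set M := system_bound cls t i; have [clsM tM iM] := system_bounds cls t i.
pose h := model N M dat; pose s x := if x is 0 then loc (Chain p (position i)) else x.*2.
have s_inj x y : s x = s y -> x = y.
  by case: x y => [|x] [|y] //=; rewrite ?doubleS /loc => -[]; lia.
pose K := fo_cells (FoSystem M cls t i).
have Vloc x : visible s K (loc x).
  apply/negP => /mapP[[|y]]; rewrite mem_iota // => _ /=.
  by rewrite /loc; lia.
have Gh : is_visgraph s K h.
  move=> u v /model_edge[x [y [-> -> xy]]]; split=> // /loc_inj; exact: next_neq xy.
have Ch : config s K h 0 by apply: config_visgraph.
have inj x y : x <= K.+1 -> y <= K.+1 -> s x = s y -> x = y by move=> _ _; apply: s_inj.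
have gE : visgraph s K h = h by apply: visgraph_id.
exists s, h; split.
  apply/sat_embed; split=> //; rewrite -/K gE.
  apply/eval_system => //; first by move=> u v /Gh[].
  split; [exact: separated_model | exact: closed_model | exists (loc (Chain p 0))].
  by rewrite entry_model // entry_node_model //; split=> //; apply/fact_model; exists p.
by apply/(sat_input_indeg _ _ inj Ch) => //; rewrite gE indeg_model.
Qed.

(** * Recursive functions as inference systems *)

Section SatisfiesTheory.
Variables (T : Type) (dat : T -> nat -> nat) (e : nat -> T).

Lemma satisfies_cons c r : satisfies dat e (c :: r) <-> holds dat e c /\ satisfies dat e r.
Proof.
split=> [H | [Hc Hr] c']; last by rewrite inE => /predU1P[->|/Hr].
by split=> [|c' c'r]; apply: H; rewrite inE ?eqxx ?c'r ?orbT.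
Qed.

Lemma satisfies1 c : satisfies dat e [:: c] <-> holds dat e c.
Proof. by rewrite satisfies_cons; split=> [[]|]. Qed.

Lemma satisfies_cat r1 r2 :
  satisfies dat e (r1 ++ r2) <-> satisfies dat e r1 /\ satisfies dat e r2.
Proof.
split=> [H | [H1 H2] c]; last by rewrite mem_cat => /orP[/H1|/H2].
by split=> c cr; apply: H; rewrite mem_cat cr ?orbT.
Qed.

Lemma satisfies_map (A : eqType) (F : A -> constr) l :
  satisfies dat e (map F l) <-> forall x, x \in l -> holds dat e (F x).
Proof.
split=> [H x xl | H c /mapP[x xl ->]]; last exact: H.
exact/H/map_f.
Qed.

Lemma satisfies_flatten (A : eqType) (F : A -> rule) l :
  satisfies dat e (flatten (map F l)) <-> forall x, x \in l -> satisfies dat e (F x).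
Proof.
split=> [H x xl c cF | H c /flatten_mapP[x xl]]; last exact: H.
by apply/H/flatten_mapP; exists x.
Qed.

End SatisfiesTheory.

(* The start of the i-th of k blocks of numbers from t on, each long enough for all F j. *)
Definition block t k (F : 'I_k -> nat) i := t + i * \max_j F j.

Lemma leq_block t k (F : 'I_k -> nat) i j : i <= j -> block t F i <= block t F j.
Proof. by move=> ij; rewrite leq_add2l leq_mul2r ij orbT. Qed.

Lemma leq_blockS t k (F : 'I_k -> nat) (i : 'I_k) : block t F i + F i <= block t F i.+1.
Proof. by rewrite /block mulSn -addnA leq_add2l [X in _ <= X]addnC leq_add2l leq_bigmax. Qed.

Lemma blockD s t k (F : 'I_k -> nat) i : s + block t F i = block (s + t) F i.
Proof. exact: addnA. Qed.

Fixpoint nflags n (f : recf n) : nat :=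
  match f with
  | RZero _ | RSucc | RProj _ _ => 1
  | RComp k _ f g => (block (nflags f) (fun i => nflags (g i)) k).+1
  | RPrec _ f g => (nflags f + nflags g).+1
  | RMu _ f => (nflags f).+2
  end.

Lemma nflags_gt0 n (f : recf n) : 0 < nflags f.
Proof. by case: f. Qed.

Section Compilation.
(* The number of flags; a fact has its result at the entry m and its
   arguments from the entry m+1 on. *)
Variable m : nat.

Definition arg j := m.+1 + j.

(* The entry j of the fact x of a rule is represented by (x, j). *)
Definition refs x i n : seq (nat * nat) := [seq (x, arg j) | j <- iota i n].

Definition call x t (args : seq (nat * nat)) (res : nat * nat) : rule :=
  [:: CZero x t, CEq x m res.1 res.2 &
      [seq CEq x (arg j) (nth (0, 0) args j).1 (nth (0, 0) args j).2 | j <- iota 0 (size args)]].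

Definition comp_rule k n tf (tg : nat -> nat) : rule :=
  call 1 tf [seq (i + 2, m) | i <- iota 0 k] (0, m) ++
  flatten [seq call (i + 2) (tg i) (refs 0 0 n) (i + 2, m) | i <- iota 0 k].

Definition prec0_rule n tf : rule := CZero 0 (arg 0) :: call 1 tf (refs 0 1 n) (0, m).

Definition precS_rule n t tg : rule :=
  CSucc 1 (arg 0) 0 (arg 0) :: call 1 t ((1, arg 0) :: refs 0 1 n) (1, m) ++
  call 2 tg [:: (1, arg 0), (1, m) & refs 0 1 n] (0, m).

Definition mu_rule n tp tf : rule :=
  CZero 2 m :: call 1 tp ((0, m) :: refs 0 0 n) (1, m) ++ call 2 tf ((0, m) :: refs 0 0 n) (2, m).

Definition posS_rule n tp tf : rule :=
  [:: CSucc 1 (arg 0) 0 (arg 0), CPos 2 m &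
      call 1 tp ((1, arg 0) :: refs 0 1 n) (1, m) ++ call 2 tf ((1, arg 0) :: refs 0 1 n) (2, m)].

(* For RMu, the auxiliary flag t+1 stands for the facts that f(z, v) is
   positive for all z < y, with arguments y, v. *)
Fixpoint compile n (f : recf n) (t : nat) {struct f} : seq clause :=
  match f with
  | RZero _ => [:: (t, [:: [:: CZero 0 m]])]
  | RSucc => [:: (t, [:: [:: CSucc 0 (arg 0) 0 m]])]
  | RProj _ i => [:: (t, [:: [:: CEq 0 m 0 (arg i)]])]
  | RComp k n f g =>
      let tg := block (t.+1 + nflags f) (fun j => nflags (g j)) in
      (t, [:: comp_rule k n t.+1 tg])
      :: compile f t.+1 ++ flatten [seq compile (g i) (tg i) | i <- enum 'I_k]
  | RPrec n f g =>
      let tg := t.+1 + nflags f in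
      (t, [:: prec0_rule n t.+1; precS_rule n t tg]) :: compile f t.+1 ++ compile g tg
  | RMu n f =>
      [:: (t, [:: mu_rule n t.+1 t.+2]),
          (t.+1, [:: [:: CZero 0 (arg 0)]; posS_rule n t.+1 t.+2])
        & compile f t.+2]
  end.

Lemma compile_flags n (f : recf n) t cl : cl \in compile f t -> t <= cl.1 < t + nflags f.
Proof.
elim: {n} f t cl => [n||n i|k n f IHf g IHg|n f IHf g IHg|n f IHf] t cl.
- by rewrite inE => /eqP-> /=; lia.
- by rewrite inE => /eqP-> /=; lia.
- by rewrite inE => /eqP-> /=; lia.
- set F := fun j => nflags (g j); rewrite inE mem_cat /= addnS -addSn blockD => in_f.
  have end_f : t.+1 + nflags f <= block (t.+1 + nflags f) F k by apply: leq_addr.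
  case/or3P: in_f => [/eqP-> | /IHf/andP[ge lt] | /flatten_mapP[i _ /IHg/andP[ge lt]]].
  - by rewrite leqnn (leq_trans _ end_f) ?leq_addr.
  - by rewrite (ltnW ge) (leq_trans lt end_f).
  have end_g := leq_trans (leq_blockS (t.+1 + nflags f) F i) (leq_block _ F (ltn_ord i)).
  rewrite (leq_trans lt end_g) andbT; apply: leq_trans ge.
  by rewrite /block -addnA addSn ltnW ?ltnS ?leq_addr.
- by rewrite inE mem_cat => /or3P[/eqP-> | /IHf | /IHg] /=; lia.
- by rewrite !inE => /or3P[/eqP-> | /eqP-> | /IHf] /=; lia.
Qed.

Lemma inj_in_cons (A : eqType) (F : A -> nat) x l : (forall y, y \in l -> F x < F y) ->
  {in l &, injective F} -> {in x :: l &, injective F}.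
Proof.
move=> lt inj y z; rewrite !inE => /predU1P[->|yl] /predU1P[->|zl] //; last exact: inj.
  by have := lt z zl; lia.
by have := lt y yl; lia.
Qed.

Lemma inj_in_cat (A : eqType) (F : A -> nat) l1 l2 :
  (forall x y, x \in l1 -> y \in l2 -> F x < F y) ->
  {in l1 &, injective F} -> {in l2 &, injective F} -> {in l1 ++ l2 &, injective F}.
Proof.
move=> lt inj1 inj2 y z; rewrite !mem_cat => /orP[y1|y2] /orP[z1|z2]; auto.
  by have := lt y z y1 z2; lia.
by have := lt z y z1 y2; lia.
Qed.

Lemma inj_in_flatten k (A : eqType) (F : A -> nat) (l : 'I_k -> seq A) :
  (forall (i j : 'I_k) x y, i < j -> x \in l i -> y \in l j -> F x < F y) ->
  (forall i, {in l i &, injective F}) ->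
  {in flatten [seq l i | i <- enum 'I_k] &, injective F}.
Proof.
move=> lt inj y z /flatten_mapP[i _ yi] /flatten_mapP[j _ zj] E.
have [ij|ji|/val_inj ij] := ltngtP i j.
- by have := lt i j y z ij yi zj; rewrite E ltnn.
- by have := lt j i z y ji zj yi; rewrite E ltnn.
by rewrite -ij in zj; apply: inj yi zj E.
Qed.

Lemma compile_inj n (f : recf n) t : {in compile f t &, injective fst}.
Proof.
elim: {n} f t => [n||n i|k n f IHf g IHg|n f IHf g IHg|n f IHf] t /=;
  try by move=> cl cl'; rewrite !inE => /eqP-> /eqP->.
- apply: inj_in_cons => [cl | ].
    rewrite mem_cat => /orP[|/flatten_mapP[i _]] /compile_flags/andP[ge _] //.
    by apply: leq_trans ge; rewrite /block -addnA addSn ltnS leq_addr.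
  apply: inj_in_cat => // [cl cl' | ].
    move=> /compile_flags/andP[_ lt] /flatten_mapP[i _ /compile_flags/andP[ge _]].
    by apply: leq_trans lt (leq_trans _ ge); rewrite /block leq_addr.
  apply: inj_in_flatten => // i j cl cl' ij.
  move=> /compile_flags/andP[_ lt] /compile_flags/andP[ge _].
  by apply: leq_trans lt (leq_trans (leq_blockS _ _ i) (leq_trans _ ge)); apply: leq_block.
- apply: inj_in_cons => [cl | ]; first by rewrite mem_cat => /orP[] /compile_flags /=; lia.
  apply: inj_in_cat => // cl cl' /compile_flags/andP[_ lt] /compile_flags/andP[ge _].
  exact: leq_trans lt ge.
- apply: inj_in_cons => [cl | ]; first by rewrite inE => /predU1P[->|/compile_flags] /=; lia.
  by apply: inj_in_cons => // cl /compile_flags /=; lia.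
Qed.

Section Encoding.
Variables (T : Type) (dat : T -> nat -> nat).

(* q is the fact that the function of flag t has value y at w. *)
Definition encodes q t (w : seq nat) y : Prop :=
  [/\ dat q t = 0, forall j, j < size w -> dat q (arg j) = nth 0 w j & dat q m = y].

Variable e : nat -> T.

Let val (z : nat * nat) := dat (e z.1) z.2.

Lemma satisfies_call x t args res :
  satisfies dat e (call x t args res) <-> encodes (e x) t (map val args) (val res).
Proof.
rewrite !satisfies_cons satisfies_map /encodes size_map /=.
split=> [[xt [xm H]] | [xt H xm]].
  by split=> // j jn; rewrite (nth_map (0, 0)) // H // mem_iota.
by do 2 (split=> //); move=> j; rewrite mem_iota => jn; rewrite H // (nth_map (0, 0)).
Qed.

Lemma map_refs x t w y i n : encodes (e x) t w y -> size w = i + n ->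
  map val (refs x i n) = drop i w.
Proof.
move=> [_ H _] sw; apply: (@eq_from_nth _ 0) => [|j]; rewrite !size_map size_iota.
  by rewrite size_drop sw addKn.
by move=> jn; rewrite nth_drop (nth_map (0, 0)) ?size_map ?size_iota // (nth_map 0)
  ?size_iota // nth_iota // /val H // sw ltn_add2l.
Qed.

Section Conclusion.
Variables (t0 : nat) (y : nat) (u : seq nat) (n : nat).
Hypothesis sz : size u = n.

Lemma satisfies_comp k tf tg : encodes (e 0) t0 u y ->
  satisfies dat e (comp_rule k n tf tg) <-> exists w, [/\ size w = k, encodes (e 1) tf w y &
    forall i, i < k -> encodes (e (i + 2)) (tg i) u (nth 0 w i)].
Proof.
move=> e0; have [_ _ e0m] := e0; rewrite satisfies_cat satisfies_call satisfies_flatten /val e0m.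
rewrite -map_comp /comp /=; split=> [[ef eg] | [w [sw ef eg]]].
  exists [seq dat (e (i + 2)) m | i <- iota 0 k]; rewrite size_map size_iota; split=> // i ik.
  have /eg/satisfies_call : i \in iota 0 k by rewrite mem_iota.
  by rewrite (map_refs e0) ?sz // drop0 (nth_map 0) ?size_iota // nth_iota.
have wE : [seq dat (e (i + 2)) m | i <- iota 0 k] = w.
  apply: (@eq_from_nth _ 0) => [|i]; rewrite size_map size_iota ?sw // => ik.
  by rewrite (nth_map 0) ?size_iota // nth_iota //; have [_ _ ->] := eg i ik.
rewrite wE; split=> // i; rewrite mem_iota => ik; apply/satisfies_call.
by rewrite (map_refs e0) ?sz // drop0 /val; have [_ _ ->] := eg i ik; apply: eg.
Qed.

Lemma satisfies_prec0 a tf : encodes (e 0) t0 (a :: u) y ->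
  satisfies dat e (prec0_rule n tf) <-> a = 0 /\ encodes (e 1) tf u y.
Proof.
move=> e0; have [_ e0a e0m] := e0.
rewrite satisfies_cons satisfies_call (map_refs e0) /= ?sz // drop0 (e0a 0) //.
by rewrite /val e0m.
Qed.

Lemma satisfies_precS a t tg : encodes (e 0) t0 (a :: u) y ->
  satisfies dat e (precS_rule n t tg) <-> exists b z,
    [/\ a = b.+1, encodes (e 1) t (b :: u) z & encodes (e 2) tg [:: b, z & u] y].
Proof.
move=> e0; have [_ e0a e0m] := e0.
rewrite satisfies_cons satisfies_cat !satisfies_call /= (map_refs e0) /= ?sz // drop0 (e0a 0) //.
rewrite /val /= e0m; split=> [[ab [e1 e2]] | [b [z [ab e1 e2]]]].
  by exists (dat (e 1) (arg 0)), (dat (e 1) m).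
by have [_ /(_ 0 isT)/= -> ->] := e1.
Qed.

Lemma satisfies_mu tp tf : encodes (e 0) t0 u y ->
  satisfies dat e (mu_rule n tp tf) <->
  (exists z, encodes (e 1) tp (y :: u) z) /\ encodes (e 2) tf (y :: u) 0.
Proof.
move=> e0; have [_ _ e0m] := e0.
rewrite satisfies_cons satisfies_cat !satisfies_call /= (map_refs e0) ?sz // drop0.
rewrite /val /= e0m; split=> [[z2 [e1 e2]] | [[z e1] e2]].
  by rewrite z2 in e2; split=> //; exists (dat (e 1) m).
by have [_ _ ->] := e2; have [_ _ ->] := e1.
Qed.

Lemma satisfies_posS a tp tf : encodes (e 0) t0 (a :: u) y ->
  satisfies dat e (posS_rule n tp tf) <-> exists b z z',
    [/\ a = b.+1, encodes (e 1) tp (b :: u) z' & encodes (e 2) tf (b :: u) z.+1].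
Proof.
move=> e0; have [_ e0a _] := e0.
rewrite 2!satisfies_cons satisfies_cat !satisfies_call /= (map_refs e0) /= ?sz // drop0 (e0a 0) //.
rewrite /val /=; split=> [[ab [z2 [e1 e2]]] | [b [z [z' [ab e1 e2]]]]].
  by exists (dat (e 1) (arg 0)), (dat (e 2) m).-1, (dat (e 1) m); rewrite prednK.
by have [_ /(_ 0 isT)/= -> ->] := e1; have [_ _ ->] := e2.
Qed.

End Conclusion.
End Encoding.

Lemma subset_cons_cat (A : eqType) (x : A) l1 l2 (P : seq A) :
  {subset x :: l1 ++ l2 <= P} -> [/\ x \in P, {subset l1 <= P} & {subset l2 <= P}].
Proof.
by move=> sub; split=> [|z zl|z zl]; apply: sub; rewrite inE ?eqxx // mem_cat zl !orbT.
Qed.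

Lemma subset_flatten (A B : eqType) (F : A -> seq B) l (P : seq B) :
  {subset flatten (map F l) <= P} -> forall x, x \in l -> {subset F x <= P}.
Proof. by move=> sub x xl z zF; apply/sub/flatten_mapP; exists x. Qed.

Section PrecGraph.
Variables (n : nat) (f : recf n) (g : recf n.+2) (u : n.-tuple nat).

Fixpoint prec_graph (a y : nat) {struct a} : Prop :=
  match a with
  | 0 => graph f u y
  | b.+1 => exists2 z, prec_graph b z & graph g [tuple of b :: z :: u] y
  end.

End PrecGraph.

Lemma graph_prec n (f : recf n) (g : recf n.+2) a (u : n.-tuple nat) y :
  graph (RPrec f g) [tuple of a :: u] y = prec_graph f g u a y.
Proof.
rewrite -[LHS]/(prec_graph f g [tuple of behead [tuple of a :: u]] a y).
by congr prec_graph; apply: val_inj.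
Qed.

Section Soundness.
Variables (T : Type) (dom : T -> Prop) (dat : T -> nat -> nat) (P : seq clause).
Hypothesis closedP : closed_under dom dat P.

Definition asserts t w y : Prop := exists2 q, dom q & encodes dat q t w y.

Lemma asserts_rule t rs w y : (t, rs) \in P -> asserts t w y ->
  exists r e, [/\ r \in rs, encodes dat (e 0) t w y, forall x, dom (e x) & satisfies dat e r].
Proof.
move=> clP [q dq qE]; have [qt _ _] := qE.
by have [r rrs [e [e0 de er]]] := closedP dq clP qt; exists r, e; rewrite e0.
Qed.

Definition sound_for n (f : recf n) t : Prop :=
  forall (v : n.-tuple nat) y, asserts t v y -> graph f v y.

Lemma prec_sound n (f : recf n) (g : recf n.+2) t tg (u : n.-tuple nat) a y :
  sound_for f t.+1 -> sound_for g tg ->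
  (t, [:: prec0_rule n t.+1; precS_rule n t tg]) \in P ->
  asserts t (a :: u) y -> prec_graph f g u a y.
Proof.
move=> sf sg clP; elim: a y => [|a IH] y /(asserts_rule clP)[r [e [+ e0 de]]].
  rewrite !inE => /orP[]/eqP->.
    by move=> /(satisfies_prec0 (size_tuple u) _ e0)[_ e1]; apply: sf; exists (e 1).
  by move=> /(satisfies_precS (size_tuple u) _ _ e0)[b [z []]].
rewrite !inE => /orP[]/eqP->; first by move=> /(satisfies_prec0 (size_tuple u) _ e0)[].
move=> /(satisfies_precS (size_tuple u) _ _ e0)[b [z [[<-] e1 e2]]].
by exists z; [apply: IH; exists (e 1) | apply: sg; exists (e 2)].
Qed.

Lemma pos_sound n (f : recf n.+1) tp tf (v : n.-tuple nat) a y :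
  sound_for f tf -> (tp, [:: [:: CZero 0 (arg 0)]; posS_rule n tp tf]) \in P ->
  asserts tp (a :: v) y -> forall z, z < a -> exists x, graph f [tuple of z :: v] x.+1.
Proof.
move=> sf clP; elim: a y => [|a IH] y // /(asserts_rule clP)[r [e [+ e0 de]]].
rewrite !inE => /orP[]/eqP->.
  by rewrite satisfies1 /=; have [_ /(_ 0 isT)/= -> _] := e0.
move=> /(satisfies_posS (size_tuple v) _ _ e0)[b [x [y' [[<-] e1 e2]]]] z.
rewrite ltnS leq_eqVlt => /predU1P[-> | za].
  by exists x; apply: sf; exists (e 2).
by apply: (IH y') za; exists (e 1).
Qed.

Lemma compile_sound n (f : recf n) t : {subset compile f t <= P} -> sound_for f t.
Proof.
elim: {n} f t => [n||n i|k n f IHf g IHg|n f IHf g IHg|n f IHf] t sub v y.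
- move=> /(asserts_rule (sub _ (mem_head _ _)))[r [e [/[!inE]/eqP-> [_ _ <-] _]]].
  by rewrite satisfies1.
- move=> /(asserts_rule (sub _ (mem_head _ _)))[r [e [/[!inE]/eqP-> [_ e0 <-] _]]].
  by rewrite satisfies1 /= e0 ?size_tuple // => ->; rewrite (tuple_eta v).
- move=> /(asserts_rule (sub _ (mem_head _ _)))[r [e [/[!inE]/eqP-> [_ e0 <-] _]]].
  by rewrite satisfies1 /= e0 ?size_tuple // => ->; rewrite (tnth_nth 0).
- have [clP /IHf sf /subset_flatten subg] := subset_cons_cat sub.
  move=> /(asserts_rule clP)[r [e [/[!inE]/eqP-> e0 de]]].
  case/(satisfies_comp (size_tuple v) _ _ _ e0)=> w [sw e1 eg].
  exists (tcast sw (in_tuple w)) => [i|]; last by apply: sf; exists (e 1); rewrite ?val_tcast.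
  rewrite (tnth_nth 0) val_tcast; apply: (IHg i _ (subg i (mem_enum _ _))).
  by exists (e (i + 2)) => //; apply: eg.
- have [clP /IHf sf /IHg sg] := subset_cons_cat sub.
  by case/tupleP: v => a u; rewrite graph_prec; apply: prec_sound sf sg clP.
- have [clP clP' sf] : [/\ (t, [:: mu_rule n t.+1 t.+2]) \in P,
      (t.+1, [:: [:: CZero 0 (arg 0)]; posS_rule n t.+1 t.+2]) \in P & sound_for f t.+2].
    by split; [| |apply: IHf => z zf]; apply: sub; rewrite !inE ?eqxx ?zf ?orbT.
  move=> /(asserts_rule clP)[r [e [/[!inE]/eqP-> e0 de]]].
  case/(satisfies_mu (size_tuple v) _ _ e0)=> [[z e1] e2]; split.
    by apply: sf; exists (e 2).
  by apply: (pos_sound (y := z) sf clP'); exists (e 1).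
Qed.

End Soundness.

Definition judgment : Type := (nat * seq nat * nat)%type.

Definition judgment_entry (x : judgment) i : nat :=
  let: (t, w, y) := x in
  if i < m then nat_of_bool (i != t) else if i == m then y else nth 0 w (i - m.+1).

Lemma encodes_judgment t w y : t < m -> encodes judgment_entry (t, w, y) t w y.
Proof.
move=> tm; split=> [|j jw|] /=; rewrite ?tm ?ltnn ?eqxx //.
rewrite /arg addSn ltnNge (leq_trans (leq_addr j m)) //= subSS addKn ifF //.
by apply/eqP; lia.
Qed.

Lemma judgment_flag t w y i : i < m -> judgment_entry (t, w, y) i = 0 -> i = t.
Proof. by rewrite /= => ->; case: eqP. Qed.

Lemma flag_ltn n (f : recf n) t : t + nflags f <= m -> t < m.
Proof. by apply: leq_trans; rewrite -addn1 leq_add2l nflags_gt0. Qed.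

Section Completeness.
Variable P : seq clause.
Hypothesis P_flags : forall cl, cl \in P -> cl.1 < m.
Hypothesis P_fun : forall cl cl', cl \in P -> cl' \in P -> cl.1 = cl'.1 -> cl = cl'.

Definition derivation (S : seq judgment) : Prop := closed_under (fun q => q \in S) judgment_entry P.

Definition provable (q : judgment) : Prop := exists2 S, q \in S & derivation S.

Lemma supported_subset (S S' : seq judgment) q : {subset S <= S'} ->
  supported (fun z => z \in S) judgment_entry P q ->
  supported (fun z => z \in S') judgment_entry P q.
Proof.
move=> sub H cl clc /(H cl clc)[r rc [e [e0 eS er]]].
by exists r => //; exists e; split=> // i; apply: sub.
Qed.

Lemma provable_all (qs : seq judgment) : (forall q, q \in qs -> provable q) ->
  exists2 S, {subset qs <= S} & derivation S.
Proof.
elim: qs => [|q qs IH] H; first by exists [::] => // q.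
have [S1 qS1 D1] := H q (mem_head _ _).
have [|S2 qsS2 D2] := IH; first by move=> z zqs; apply: H; rewrite inE zqs orbT.
exists (S1 ++ S2) => [z | z]; rewrite ?inE mem_cat.
  by case/predU1P=> [->|/qsS2 ->]; rewrite ?qS1 ?orbT.
by case/orP=> [/D1|/D2]; apply: supported_subset => w wS; rewrite mem_cat wS ?orbT.
Qed.

Lemma provable_rule t rs r w y qs (q : judgment := (t, w, y)) :
  (t, rs) \in P -> r \in rs -> (forall z, z \in qs -> provable z) ->
  satisfies judgment_entry (nth q (q :: qs)) r -> provable q.
Proof.
move=> clP rrs /provable_all[S qsS DS] er; exists (q :: S); first exact: mem_head.
have sub : {subset S <= q :: S} by move=> z zS; rewrite inE zS orbT.
move=> z; rewrite inE => /predU1P[-> | /DS]; last exact: supported_subset.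
move=> cl clP' /(judgment_flag (P_flags clP'))/(P_fun clP' clP (cl' := (t, rs))) ->.
exists r => //; exists (nth q (q :: qs)); split=> // i.
have [lt|ge] := ltnP i (size (q :: qs)); last by rewrite nth_default ?mem_head.
by have := mem_nth q lt; rewrite inE => /predU1P[->|/qsS/sub//]; rewrite mem_head.
Qed.

Definition complete_for n (f : recf n) t : Prop :=
  forall (v : n.-tuple nat) y, graph f v y -> provable (t, val v, y).

Lemma prec_complete n (f : recf n) (g : recf n.+2) t tg (u : n.-tuple nat) a y :
  complete_for f t.+1 -> complete_for g tg -> t.+1 < m -> tg < m ->
  (t, [:: prec0_rule n t.+1; precS_rule n t tg]) \in P ->
  prec_graph f g u a y -> provable (t, a :: u, y).
Proof.
move=> cf cg tm tgm clP; have e0 a' y' := encodes_judgment (a' :: u) y' (ltnW tm).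
elim: a y => [|a IH] y /=.
  move=> /cf uy; apply: (provable_rule clP (mem_head _ _) (qs := [:: (t.+1, val u, y)])).
    by move=> z /[!inE]/eqP->.
  by apply/(satisfies_prec0 (size_tuple u) _ (e0 _ _)); split=> //; apply: encodes_judgment.
case=> z /IH az /cg azy.
apply: (provable_rule clP (r := precS_rule n t tg)
  (qs := [:: (t, a :: u, z); (tg, [:: a, z & u], y)])).
- by rewrite inE mem_head orbT.
- by move=> q /[!inE]/orP[]/eqP->.
apply/(satisfies_precS (size_tuple u) _ _ (e0 _ _)); exists a, z.
by split=> //; apply: encodes_judgment; rewrite // ltnW.
Qed.

Lemma pos_complete n (f : recf n.+1) tp tf (v : n.-tuple nat) a :
  complete_for f tf -> tp < m -> tf < m ->
  (tp, [:: [:: CZero 0 (arg 0)]; posS_rule n tp tf]) \in P ->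
  (forall z, z < a -> exists x, graph f [tuple of z :: v] x.+1) -> provable (tp, a :: v, 0).
Proof.
move=> cf tpm tfm clP; have e0 a' := encodes_judgment (a' :: v) 0 tpm.
elim: a => [|a IH] Ha.
  apply: (provable_rule clP (mem_head _ _) (qs := [::])) => //.
  by rewrite satisfies1 /=; have [_ /(_ 0 isT)/= -> _] := e0 0.
have [x /cf ax] := Ha a (leqnn _); have av := IH (fun z za => Ha z (ltnW za)).
apply: (provable_rule clP (r := posS_rule n tp tf)
  (qs := [:: (tp, a :: val v, 0); (tf, a :: val v, x.+1)])).
- by rewrite inE mem_head orbT.
- by move=> q /[!inE]/orP[]/eqP->.
apply/(satisfies_posS (size_tuple v) _ _ (e0 _)); exists a, x, 0.
by split=> //; apply: encodes_judgment.
Qed.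

Lemma comp_complete k n (f : recf k) (g : 'I_k -> recf n) t (tg : nat -> nat)
    (v : n.-tuple nat) y :
  complete_for f t.+1 -> (forall i, complete_for (g i) (tg i)) ->
  t.+1 < m -> (forall i, i < k -> tg i < m) ->
  (t, [:: comp_rule k n t.+1 tg]) \in P ->
  graph (RComp f g) v y -> provable (t, val v, y).
Proof.
move=> cf cg tm tgm clP [w vw /cf wy].
pose q (i : 'I_k) : judgment := (tg i, val v, tnth w i).
apply: (provable_rule clP (mem_head _ _) (qs := (t.+1, val w, y) :: map q (enum 'I_k))).
  by move=> z; rewrite inE => /predU1P[->|/mapP[i _ ->]] //; apply/cg/vw.
apply/(satisfies_comp (size_tuple v) _ _ _ (encodes_judgment _ _ (ltnW tm))); exists w.
split; [exact: size_tuple | exact: encodes_judgment | move=> i ik].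
rewrite addn2 /= (nth_map (Ordinal ik)) ?size_enum_ord //.
have -> : nth (Ordinal ik) (enum 'I_k) i = Ordinal ik by apply: val_inj; rewrite /= nth_enum_ord.
by rewrite /q (tnth_nth 0); apply: encodes_judgment; apply: tgm.
Qed.

Lemma compile_complete n (f : recf n) t : t + nflags f <= m ->
  {subset compile f t <= P} -> complete_for f t.
Proof.
elim: {n} f t => [n||n i|k n f IHf g IHg|n f IHf g IHg|n f IHf] t tm sub v y.
- move=> /= ->; apply: (provable_rule (sub _ (mem_head _ _)) (mem_head _ _) (qs := [::])) => //.
  have [_ _ res] := @encodes_judgment t v 0 (flag_ltn tm).
  by rewrite satisfies1.
- move=> /= ->; apply: (provable_rule (sub _ (mem_head _ _)) (mem_head _ _) (qs := [::])) => //.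
  have [_ args res] := @encodes_judgment t v (thead v).+1 (flag_ltn tm).
  by rewrite satisfies1 /holds res args ?size_tuple // -(tnth_nth 0 v ord0).
- move=> /= ->; apply: (provable_rule (sub _ (mem_head _ _)) (mem_head _ _) (qs := [::])) => //.
  have [_ args res] := @encodes_judgment t v (tnth v i) (flag_ltn tm).
  by rewrite satisfies1 /holds res args ?size_tuple // (tnth_nth 0).
- have [clP /IHf cf /subset_flatten subg] := subset_cons_cat sub.
  have tgm (i : 'I_k) : block (t.+1 + nflags f) (fun j => nflags (g j)) i + nflags (g i) <= m.
    apply: leq_trans (leq_blockS _ _ i) (leq_trans (leq_block _ _ (ltn_ord i)) _).
    by apply: leq_trans tm; rewrite /= addnS -addSn blockD.
  apply: comp_complete clP.
  - by apply: cf; move: tm; rewrite /= /block; lia.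
  - by move=> i; apply: (IHg i) (tgm i) (subg i (mem_enum _ _)).
  - by move: tm (nflags_gt0 f); rewrite /= /block; lia.
  by move=> i ik; apply: flag_ltn (tgm (Ordinal ik)).
- have [clP /IHf cf /IHg cg] := subset_cons_cat sub.
  have [f0 g0] := (nflags_gt0 f, nflags_gt0 g).
  case/tupleP: v => a u; rewrite graph_prec; apply: prec_complete clP.
  + by apply: cf; move: tm => /=; lia.
  + by apply: cg; move: tm => /=; lia.
  + by move: tm => /=; lia.
  + by move: tm => /=; lia.
- have [clP clP' subf] : [/\ (t, [:: mu_rule n t.+1 t.+2]) \in P,
      (t.+1, [:: [:: CZero 0 (arg 0)]; posS_rule n t.+1 t.+2]) \in P &
      {subset compile f t.+2 <= P}].
    by split; [| |move=> z zf]; apply: sub; rewrite !inE ?eqxx ?zf ?orbT.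
  have [f0 tm'] : 0 < nflags f /\ t.+2 + nflags f <= m.
    by split; [exact: nflags_gt0 | move: tm => /=; lia].
  have cf := IHf _ tm' subf; case=> /cf y0 /(pos_complete cf _ _ clP') vpos.
  apply: (provable_rule clP (mem_head _ _)
    (qs := [:: (t.+1, y :: val v, 0); (t.+2, y :: val v, 0)])).
    by move=> q /[!inE]/orP[]/eqP-> //; apply: vpos; lia.
  apply/(satisfies_mu (size_tuple v) _ _ (encodes_judgment _ _ _)); first by lia.
  by split; [exists 0|]; apply: encodes_judgment; lia.
Qed.

End Completeness.

End Compilation.

Lemma derivation_closed m P (S : seq judgment) q : derivation m P S ->
  closed_under (fun i => i < size S) (fun i => judgment_entry m (nth q S i)) P.
Proof.
move=> DS i iS cl clP /(DS _ (mem_nth q iS) cl clP)[r rc [e [e0 eS er]]]; exists r => //.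
pose e' j := if j is 0 then i else index (e j) S.
have e'E j : nth q S (e' j) = e j by case: j => [|j] //; rewrite /e' nth_index.
exists e'; split=> // [[|j] // | c cr]; first by rewrite /e' index_mem.
by have := er c cr; case: c {cr} => [x a y b|x a y b|x a|x a]; rewrite /holds !e'E.
Qed.

Lemma halting_formula (f : recf 1) : exists A, forall n,
  (exists s h, sat s h A /\ sat s h (iter n.+1 (FStar FInputCell) FNoInput)) <->
  exists y, graph f [tuple n] y.
Proof.
pose m := nflags f; have m_gt0 : 0 < m := nflags_gt0 f.
exists (FSystem (compile m f 0) 0 (arg m 0)) => n; split=> [[s [h [sys inp]]] | [y fy]].
  have [dom [dat [C [p [dp pt pn]]]]] := system_sound sys inp.
  exists (dat p m); have sf := compile_sound C (f := f) (t := 0) (fun cl clP => clP).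
  apply: sf; exists p => //.
  by split=> // -[|j].
have flags cl : cl \in compile m f 0 -> cl.1 < m by move/compile_flags.
have [S qS DS] : provable m (compile m f 0) (0, [:: n], y).
  by apply: (compile_complete flags (@compile_inj m _ f 0)) fy.
have [q0 qn _] := encodes_judgment [:: n] y m_gt0.
have qlt : index (0, [:: n], y) S < size S by rewrite index_mem.
have C := derivation_closed (q := (0, [:: n], y)) DS.
by apply: (system_complete C qlt); rewrite nth_index ?qn.
Qed.

(** * Diagonalization *)

Definition computes n (f : recf n) (F : seq nat -> nat) : Prop :=
  forall (v : n.-tuple nat) y, graph f v y <-> y = F v.

Lemma eq_computes n (f : recf n) (F G : seq nat -> nat) :
  (forall v : n.-tuple nat, F v = G v) -> computes f F -> computes f G.
Proof. by move=> FG Ff v y; rewrite Ff FG. Qed.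

Definition rproj n i : recf n.+1 := RProj (inord i).

Lemma computes_proj n i : i <= n -> computes (rproj n i) (fun v => nth 0 v i).
Proof. by move=> le v y /=; rewrite (tnth_nth 0) inordK. Qed.

Lemma computes_zero n : computes (RZero n) (fun=> 0).
Proof. by []. Qed.

Lemma computes_succ : computes RSucc (fun v => (nth 0 v 0).+1).
Proof. by move=> v y; rewrite -(tnth_nth 0 v ord0). Qed.

Definition rcomp k n (f : recf k) (gs : k.-tuple (recf n)) : recf n := RComp f (tnth gs).

Lemma computes_comp k n (f : recf k) (gs : k.-tuple (recf n)) F (Gs : k.-tuple (seq nat -> nat)) :
  computes f F -> (forall i, computes (tnth gs i) (tnth Gs i)) ->
  computes (rcomp f gs) (fun v => F [seq G v | G <- Gs]).
Proof.
move=> Ff Gg v y; split=> [[w wv /Ff ->] | ->].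
  have -> // : w = map_tuple (fun G : seq nat -> nat => G v) Gs.
  by apply: eq_from_tnth => i; rewrite tnth_map; apply/Gg/wv.
exists (map_tuple (fun G : seq nat -> nat => G v) Gs); last exact/Ff.
by move=> i; rewrite tnth_map; apply/Gg.
Qed.

Definition rcomp1 n (f : recf 1) (g : recf n) : recf n := rcomp f [tuple g].
Lemma graph_comp1 n f (g : recf n) v y :
  graph (rcomp1 f g) v y <-> exists2 z, graph g v z & graph f [tuple z] y.
Proof.
split=> [[w /(_ ord0)] | [z gz fz]]; last by exists [tuple z] => // i; rewrite (ord1 i).
by case/tupleP: w => z u; rewrite (tuple0 u); exists z.
Qed.

Definition rcomp2 n (f : recf 2) (g1 g2 : recf n) : recf n := rcomp f [tuple g1; g2].

Lemma computes_comp1 n f (g : recf n) F G : computes f F -> computes g G ->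
  computes (rcomp1 f g) (fun v => F [:: G v]).
Proof.
move=> Ff Gg; apply: (computes_comp (Gs := [tuple G]) Ff) => i.
by rewrite (ord1 i).
Qed.

Lemma computes_comp2 n f (g1 g2 : recf n) F G1 G2 :
  computes f F -> computes g1 G1 -> computes g2 G2 ->
  computes (rcomp2 f g1 g2) (fun v => F [:: G1 v; G2 v]).
Proof.
move=> Ff Gg1 Gg2; apply: (computes_comp (Gs := [tuple G1; G2]) Ff) => i.
by case: (unliftP ord0 i) => [j|] ->; rewrite ?(ord1 j).
Qed.

Fixpoint prec_fun (F G : seq nat -> nat) u a :=
  if a is b.+1 then G [:: b, prec_fun F G u b & u] else F u.

Lemma computes_prec n (f : recf n) g F G : computes f F -> computes g G ->
  computes (RPrec f g) (fun v => prec_fun F G (behead v) (nth 0 v 0)).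
Proof.
move=> Ff Gg v y; case/tupleP: v => a u; rewrite graph_prec /=.
elim: a y => [|a IH] y; first exact: Ff.
split=> [[z /IH-> /Gg->] // | ->].
by exists (prec_fun F G u a); [apply/IH | apply/Gg].
Qed.

Fixpoint rconst n c : recf n := if c is c'.+1 then rcomp1 RSucc (rconst n c') else RZero n.

Lemma computes_const n c : computes (rconst n c) (fun=> c).
Proof.
elim: c => [|c IH]; first exact: computes_zero.
exact: (computes_comp1 computes_succ IH).
Qed.

Definition radd : recf 2 := RPrec (rproj 0 0) (rcomp1 RSucc (rproj 2 1)).

Lemma computes_add : computes radd (fun v => nth 0 v 0 + nth 0 v 1).
Proof.
have := computes_prec (computes_proj (leqnn 0))
  (computes_comp1 computes_succ (@computes_proj 2 1 isT)).
apply: eq_computes => v; case/tupleP: v => a u /=.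
by elim: a => //= a ->; rewrite addSn.
Qed.

Definition rtri : recf 1 := RPrec (RZero 0) (rcomp2 radd (rproj 1 1) (rcomp1 RSucc (rproj 1 0))).

Lemma computes_tri : computes rtri (fun v => 'C((nth 0 v 0).+1, 2)).
Proof.
have := computes_prec (computes_zero (n := 0)) (computes_comp2 computes_add
  (@computes_proj 1 1 isT) (computes_comp1 computes_succ (@computes_proj 1 0 isT))).
apply: eq_computes => v; elim: (nth 0 v 0) => //= a ->.
by rewrite (binS a.+1 1) bin1 addnC.
Qed.

Definition rpair n (f g : recf n) : recf n := rcomp2 radd (rcomp1 rtri (rcomp2 radd f g)) g.

Lemma computes_pair n (f g : recf n) F G : computes f F -> computes g G ->
  computes (rpair f g) (fun v => cpair (F v) (G v)).
Proof.
move=> Ff Gg; have Ffg := computes_comp2 computes_add Ff Gg.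
exact: (computes_comp2 computes_add (computes_comp1 computes_tri Ffg) Gg).
Qed.

Section Diagonal.
Variables p q : form.

Definition rstar : recf 1 := RPrec (rconst 0 (gnum q))
  (rpair (rconst 2 6) (rpair (rconst 2 (gnum p)) (rproj 1 1))).

Lemma computes_star : computes rstar (fun v => gnum (iter (nth 0 v 0) (FStar p) q)).
Proof.
have := computes_prec (@computes_const 0 (gnum q)) (computes_pair (@computes_const 2 6)
  (computes_pair (@computes_const 2 (gnum p)) (@computes_proj 1 1 isT))).
apply: eq_computes => v; elim: (nth 0 v 0) => [|a IH] //.
by rewrite [prec_fun _ _ _ _]/(cpair 6 (cpair (gnum p) (prec_fun _ _ _ _))) IH.
Qed.

Definition FDiag A n := FNeg (FAnd A (iter n.+1 (FStar p) q)).

Definition rdiag : recf 1 :=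
  rpair (rconst 1 4) (rpair (rconst 1 5) (rpair (rproj 0 0) (rcomp1 rstar RSucc))).

Lemma graph_diag A y :
  graph rdiag [tuple gnum A] y <-> y = gnum (FDiag A (gnum A)).
Proof.
exact: (computes_pair (@computes_const 1 4) (computes_pair (@computes_const 1 5)
  (computes_pair (computes_proj (leqnn 0)) (computes_comp1 computes_star computes_succ)))
  [tuple gnum A] y).
Qed.

Lemma valid_diag A n :
  ~ valid (FDiag A n) <-> exists s h, sat s h A /\ sat s h (iter n.+1 (FStar p) q).
Proof.
split=> [N | [s [h Ah]] /(_ s h)]; last exact.
by apply: NNPP => N'; apply: N => s h Ah; apply: N'; exists s, h.
Qed.

Lemma valid_not_re :
  (forall f : recf 1, exists A, forall n,
     (exists s h, sat s h A /\ sat s h (iter n.+1 (FStar p) q)) <->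
     exists y, graph f [tuple n] y) -> ~ form_re valid.
Proof.
move=> halting [f fP]; have [A AP] := halting (rcomp1 f rdiag).
pose c := gnum (FDiag A (gnum A)).
have fdiag : (exists y, graph (rcomp1 f rdiag) [tuple gnum A] y) <-> exists y, graph f [tuple c] y.
  split=> -[y]; first by case/graph_comp1=> z /graph_diag ->; exists y.
  by exists y; apply/graph_comp1; exists c => //; apply/graph_diag.
have validP : (exists2 phi, c = gnum phi & valid phi) <-> valid (FDiag A (gnum A)).
  by split=> [[phi /gnum_inj <-] | V] //; exists (FDiag A (gnum A)).
have := fP c; have := valid_diag A (gnum A); rewrite validP AP fdiag; tauto.
Qed.

End Diagonal.

Theorem theorem3p13 : ~ form_re valid.
Proof. exact: valid_not_re halting_formula. Qed.
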